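(* Let $p\in\mathbb N$, $m\in\mathbb Z$, $\alpha\in\mathbb R$, $\beta>0$ with $\alpha+p\beta>0$, and $-1\le B<A\le1$. Let $f\in\mathcal A_p$, and suppose $g\in\mathcal A_p$ satisfies $$\frac{\Theta_p^{m+2}(\alpha,\beta)g(z)}{\Theta_p^{m+1}(\alpha,\beta)g(z)}\prec\frac{1+Az}{1+Bz}\quad(z\in\mathbb U).$$ If $$\Theta_p^{m+1}(\alpha,\beta)f(z)\ll\Theta_p^{m+1}(\alpha,\beta)g(z)\quad(z\in\mathbb U),$$ then $$\left|\Theta_p^{m+2}(\alpha,\beta)f(z)\right|\le\left|\Theta_p^{m+2}(\alpha,\beta)g(z)\right|\quad(|z|<\widetilde r),$$ where $\widetilde r=\widetilde r(p,\alpha,\beta,A,B)$ is the smallest positive root of the equation $$(\alpha+p\beta)|A|r^3-\bigl((\alpha+p\beta)+2\beta|B|\bigr)r^2-\bigl((\alpha+p\beta)|A|+2\beta\bigr)r+(\alpha+p\beta)=0.$$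
   Context: $\mathbb U=\{z\in\mathbb C:|z|<1\}$. $\mathcal A_p$ is the class of functions $f(z)=z^p+\sum_{k\ge p+1}a_kz^k$ which are analytic and $p$-valent in $\mathbb U$. For $m\in\mathbb Z$ the linear operator $\Theta_p^m(\alpha,\beta)$ on $\mathcal A_p$ is $$\Theta_p^m(\alpha,\beta)f(z)=z^p+\sum_{k=p+1}^\infty\left(\frac{\alpha+k\beta}{\alpha+p\beta}\right)^m a_kz^k .$$ For functions $F,G$ analytic in $\mathbb U$: $F\prec G$ means $F=G\circ w$ for some analytic $w:\mathbb U\to\mathbb U$ with $w(0)=0$; $F\ll G$ ($F$ is majorized by $G$) means there is an analytic $\varphi$ in $\mathbb U$ with $|\varphi(z)|\le1$ and $F(z)=\varphi(z)G(z)$ for $z\in\mathbb U$. A subordination for a quotient is understood to include that the quotient is analytic in $\mathbb U$ after removing the removable singularity at $0$. *)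

(* Defs.v *)
From Stdlib Require Import Reals ZArith List.
From Coquelicot Require Import Coquelicot.
Import ListNotations.
Open Scope R_scope.

Definition in_disc (z : C) : Prop := Cmod z < 1.

Definition analytic_at (f : C -> C) (z0 : C) : Prop :=
  exists (c : nat -> C) (rho : R), 0 < rho /\
    forall z : C, Cmod (z - z0)%C < rho -> is_pseries c (z - z0)%C (f z).

Definition analytic_in_disc (f : C -> C) : Prop :=
  forall z : C, in_disc z -> analytic_at f z.

(** Zero of exact order [n]; [n = 0] means [f z0 <> 0]. *)
Definition zero_of_order (f : C -> C) (z0 : C) (n : nat) : Prop :=
  exists h : C -> C, analytic_in_disc h /\ h z0 <> 0%C /\
    forall z : C, in_disc z -> f z = ((z - z0) ^ n * h z)%C.

(** [l] lists distinct [w]-points of [f] in the disc, paired with their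
    multiplicities. *)
Definition w_points (f : C -> C) (w : C) (l : list (C * nat)) : Prop :=
  NoDup (map fst l) /\
  forall (z0 : C) (n : nat), In (z0, n) l ->
    in_disc z0 /\ zero_of_order (fun z => (f z - w)%C) z0 n.

(** No value is taken more than [p] times, and some value is taken exactly
    [p] times, counting multiplicities. *)
Definition p_valent (p : nat) (f : C -> C) : Prop :=
  (forall (w : C) (l : list (C * nat)),
     w_points f w l -> (list_sum (map snd l) <= p)%nat) /\
  (exists (w : C) (l : list (C * nat)),
     w_points f w l /\ list_sum (map snd l) = p).

(** The class [A_p].  Only the coefficients [Ap_coef k] with [k >= p + 1] are
    meaningful; they are determined by [Ap_fun]. *)
Record Ap (p : nat) : Type := mk_Ap {
  Ap_fun :> C -> C;
  Ap_coef : nat -> C;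
  Ap_expansion : forall z : C, in_disc z ->
    is_series (fun j : nat => (Ap_coef (p + 1 + j) * z ^ (p + 1 + j))%C)
              (Ap_fun z - z ^ p)%C;
  Ap_analytic : analytic_in_disc Ap_fun;
  Ap_valent : p_valent p Ap_fun
}.

Arguments Ap_fun {p} _ _.
Arguments Ap_coef {p} _ _.

(** Sum of a complex series (junk value when it diverges). *)
Definition CSeries (u : nat -> C) : C :=
  (Series (fun j => Re (u j)), Series (fun j => Im (u j))).

Definition Theta (p : nat) (m : Z) (alpha beta : R) (f : Ap p) (z : C) : C :=
  (z ^ p +
   CSeries (fun j : nat =>
     let k := (p + 1 + j)%nat in
     RtoC (powerRZ ((alpha + INR k * beta) / (alpha + INR p * beta)) m)
       * Ap_coef f k * z ^ k))%C.

Definition subordinate (F G : C -> C) : Prop :=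
  exists w : C -> C,
    analytic_in_disc w /\ (forall z, in_disc z -> in_disc (w z)) /\
    w 0%C = 0%C /\ forall z, in_disc z -> F z = G (w z).

Definition majorized (F G : C -> C) : Prop :=
  exists phi : C -> C,
    analytic_in_disc phi /\ (forall z, in_disc z -> Cmod (phi z) <= 1) /\
    forall z, in_disc z -> F z = (phi z * G z)%C.

(** [q] is the quotient [F / G], analytic in the whole disc once its removable
    singularity at [0] has been removed. *)
Definition is_quotient (F G q : C -> C) : Prop :=
  analytic_in_disc q /\
  forall z, in_disc z -> z <> 0%C -> G z <> 0%C /\ q z = (F z / G z)%C.

Definition quotient_subordinate (F G H : C -> C) : Prop :=
  exists q : C -> C, is_quotient F G q /\ subordinate q H.

Definition smallest_positive_root (P : R -> R) (r : R) : Prop :=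
  0 < r /\ P r = 0 /\ forall s : R, 0 < s -> P s = 0 -> r <= s.

Definition radius_poly (p : nat) (alpha beta A B : R) (r : R) : R :=
  (alpha + INR p * beta) * Rabs A * r ^ 3
  - ((alpha + INR p * beta) + 2 * beta * Rabs B) * r ^ 2
  - ((alpha + INR p * beta) * Rabs A + 2 * beta) * r
  + (alpha + INR p * beta).

(* Main.v *)
(* Write F, G for Theta^(m+1) of f, g, write F1, G1 for Theta^(m+2) of f, g,
   and put c = alpha + p beta. Comparing coefficients, c F1 = alpha F + beta z F'
   and likewise for g, so F = phi G gives F1 = phi G1 + (beta / c) z phi' G.
   With rho = |z|, the subordination and Schwarz's lemma bound |G| by
   |G1| (1 + |B| rho) / (1 - |A| rho), and Schwarz-Pick bounds |phi'| by
   (1 - |phi|^2) / (1 - rho^2); as 1 - |phi|^2 <= 2 (1 - |phi|), the claim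
   |F1| <= |G1| follows once 2 beta rho (1 + |B| rho) is at most
   c (1 - rho^2) (1 - |A| rho), which is the positivity of the radius polynomial.

   Analyticity being given by local power series, Schwarz-Pick is derived without
   Cauchy's theorem: the maximum principle holds because |h|^2 + eps |z|^2 has,
   on small squares centred at any point, a mean exceeding its central value. *)

Require Import Defs.
From Stdlib Require Import Reals ZArith Lra Lia Classical ClassicalEpsilon.
From Coquelicot Require Import Coquelicot.
Open Scope R_scope.

(** Analyticity provides a separate power series around each point, so nothing is known directly
    about quotients such as [h] in the Schwarz-Pick argument. Finite Taylor expansions ([jet])
    replace power series there: they are stable under sums, products, inverses and division by
    [z - z0], which avoids Cauchy products and reciprocals of series. Since [phi] need not extend to
    the unit circle, the maximum principle is applied on circles of radius below 1 and the radius is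
    then sent to 1. On the other side, [Theta] is one series on the whole disc, with real and
    imaginary parts summed separately. Its multipliers lie between 1 and a linear function of the
    index, so their integer powers, negative ones included, leave the radius of convergence at least
    1; this legitimates the comparison of coefficients. The two sides meet in [derivative_at], whose
    uniqueness identifies the derivative of [F] with the one given by the product rule for
    [phi G]. *)

(** * Moduli and derivatives of complex functions *)

Lemma Cmod_le_abs_Re_Im (z : C) : Cmod z <= Rabs (Re z) + Rabs (Im z).
Proof.
  destruct z as [a b]; cbn [Re Im fst snd].
  replace ((a, b) : C) with (RtoC a + Ci * RtoC b)%C
    by (unfold Ci; apply injective_projections; cbn; ring).
  eapply Rle_trans; [apply Cmod_triangle|].
  rewrite Cmod_mult, !Cmod_R, Cmod_Ci; lra.
Qed.

Lemma Cmod_le_sub (x y : C) : Cmod x <= Cmod y + Cmod (x - y)%C.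
Proof.
  replace x with (y + (x - y))%C at 1 by ring; apply Cmod_triangle.
Qed.

Lemma Cmod_sub_sym (x y : C) : Cmod (x - y)%C = Cmod (y - x)%C.
Proof.
  replace (x - y)%C with (- (y - x))%C by ring; apply Cmod_opp.
Qed.

Lemma Cmod_sub_diag (x : C) : Cmod (x - x)%C = 0.
Proof.
  replace (x - x)%C with (RtoC 0) by ring; apply Cmod_0.
Qed.

Lemma Cmod_sub_gt_0 (x y : C) : x <> y -> 0 < Cmod (x - y)%C.
Proof.
  intros H; apply Cmod_gt_0; intros E; apply H.
  replace x with (y + (x - y))%C by ring; rewrite E; ring.
Qed.

(* Linear approximation with a quadratic error: stronger than complex
   differentiability, and enough for all the functions at hand. *)
Definition derivative_at (f : C -> C) (z0 c : C) : Prop :=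
  exists K d : R, 0 < d /\ 0 <= K /\
    forall z, Cmod (z - z0)%C < d ->
      Cmod (f z - f z0 - c * (z - z0))%C <= K * Cmod (z - z0)%C ^ 2.

(** At a displacement [t] the two linear terms differ by [|c - c'| t], yet by at most
    [(K + K') t^2]. Only local agreement is assumed because majorization speaks of points of the
    disc alone. *)
Lemma derivative_at_unique (f g : C -> C) (z0 c c' : C) (d : R) :
  0 < d -> (forall z, Cmod (z - z0)%C < d -> f z = g z) ->
  derivative_at f z0 c -> derivative_at g z0 c' -> c = c'.
Proof.
  intros Hd Hfg (K & d1 & Hd1 & HK & H1) (K' & d2 & Hd2 & HK' & H2).
  apply NNPP; intros Hne.
  pose proof (Cmod_sub_gt_0 _ _ Hne) as Hpos.
  set (e := Cmod (c - c')%C) in *.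
  assert (Ht : exists t, 0 < t /\ t < d /\ t < d1 /\ t < d2 /\ (K + K') * t < e).
  (* The [+ 1] in the denominator covers [K + K' = 0]; halving the minimum makes the inequalities
     strict. *)
  { exists (Rmin (Rmin d (Rmin d1 d2)) (e / (K + K' + 1)) / 2).
    assert (0 < e / (K + K' + 1)) by (apply Rdiv_lt_0_compat; lra).
    set (m := Rmin (Rmin d (Rmin d1 d2)) (e / (K + K' + 1))).
    assert (0 < m) by (unfold m; repeat apply Rmin_glb_lt; lra).
    assert (m <= d /\ m <= d1 /\ m <= d2 /\ m <= e / (K + K' + 1)).
    { unfold m.
      pose proof (Rmin_l (Rmin d (Rmin d1 d2)) (e / (K + K' + 1))).
      pose proof (Rmin_r (Rmin d (Rmin d1 d2)) (e / (K + K' + 1))).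
      pose proof (Rmin_l d (Rmin d1 d2)). pose proof (Rmin_r d (Rmin d1 d2)).
      pose proof (Rmin_l d1 d2). pose proof (Rmin_r d1 d2). lra. }
    assert ((K + K') * m <= e).
    { apply Rle_trans with ((K + K') * (e / (K + K' + 1))).
      - apply Rmult_le_compat_l; lra.
      - apply Rle_trans with ((K + K' + 1) * (e / (K + K' + 1))).
        + apply Rmult_le_compat_r; lra.
        + right; field; lra. }
    repeat split; lra. }
  destruct Ht as (t & Ht0 & Htd & Htd1 & Htd2 & Hte).
  set (z := (z0 + RtoC t)%C).
  assert (Ez : (z - z0)%C = RtoC t) by (unfold z; ring).
  assert (Mz : Cmod (z - z0)%C = t) by (rewrite Ez, Cmod_R, Rabs_pos_eq; lra).
  specialize (H1 z); specialize (H2 z). rewrite Mz in H1, H2.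
  specialize (H1 Htd1); specialize (H2 Htd2).
  rewrite (Hfg z), (Hfg z0) in H1 by (rewrite ?Mz, ?Cmod_sub_diag; lra).
  assert (Hle : e * t <= (K + K') * t ^ 2).
  { assert (e * t = Cmod ((c - c') * (z - z0))%C) as -> by (now rewrite Cmod_mult, Mz).
    replace ((c - c') * (z - z0))%C with
      ((g z - g z0 - c' * (z - z0)) - (g z - g z0 - c * (z - z0)))%C by ring.
    unfold Cminus at 1. eapply Rle_trans; [apply Cmod_triangle|].
    rewrite Cmod_opp; lra. }
  nra.
Qed.

Lemma derivative_at_ext (f g : C -> C) (z0 c : C) :
  (forall z, f z = g z) -> derivative_at f z0 c -> derivative_at g z0 c.
Proof.
  intros E (K & d & Hd & HK & H). exists K, d. repeat split; auto.
  intros z Hz. rewrite <- !E. auto.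
Qed.

Lemma derivative_at_plus (f g : C -> C) (z0 c c' : C) :
  derivative_at f z0 c -> derivative_at g z0 c' ->
  derivative_at (fun z => f z + g z)%C z0 (c + c')%C.
Proof.
  intros (K & d & Hd & HK & H) (K' & d' & Hd' & HK' & H').
  exists (K + K'), (Rmin d d'). split; [now apply Rmin_glb_lt|]. split; [lra|].
  intros z Hz. pose proof (Rmin_l d d'). pose proof (Rmin_r d d').
  specialize (H z ltac:(lra)). specialize (H' z ltac:(lra)).
  replace (f z + g z - (f z0 + g z0) - (c + c') * (z - z0))%C
    with ((f z - f z0 - c * (z - z0)) + (g z - g z0 - c' * (z - z0)))%C by ring.
  eapply Rle_trans; [apply Cmod_triangle|]. lra.
Qed.

Lemma derivative_at_mult (f g : C -> C) (z0 c c' : C) :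
  derivative_at f z0 c -> derivative_at g z0 c' ->
  derivative_at (fun z => f z * g z)%C z0 (c * g z0 + f z0 * c')%C.
Proof.
  intros (K & d & Hd & HK & H) (K' & d' & Hd' & HK' & H').
  assert (Hg0 := Cmod_ge_0 (g z0)). assert (Hf0 := Cmod_ge_0 (f z0)).
  assert (Hc := Cmod_ge_0 c). assert (Hc' := Cmod_ge_0 c').
  (* The three summands bound the three parts into which the error is split below; the cap 1 on the
     radius gives [t^2 <= t], hence a bound on [g] near [z0]. *)
  exists (K * (Cmod (g z0) + Cmod c' + K') + Cmod (f z0) * K' + Cmod c * (Cmod c' + K')),
    (Rmin (Rmin d d') 1).
  assert (HB : 0 <= Cmod (g z0) + Cmod c' + K') by lra.
  split; [repeat apply Rmin_glb_lt; lra|]. split.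
  { assert (0 <= K * (Cmod (g z0) + Cmod c' + K')) by (apply Rmult_le_pos; lra).
    assert (0 <= Cmod (f z0) * K') by (apply Rmult_le_pos; lra).
    assert (0 <= Cmod c * (Cmod c' + K')) by (apply Rmult_le_pos; lra). lra. }
  intros z Hz.
  assert (Cmod (z - z0)%C < d /\ Cmod (z - z0)%C < d' /\ Cmod (z - z0)%C < 1)
    as (Z1 & Z2 & Z3).
  { pose proof (Rmin_l (Rmin d d') 1). pose proof (Rmin_r (Rmin d d') 1).
    pose proof (Rmin_l d d'). pose proof (Rmin_r d d'). lra. }
  specialize (H z Z1); specialize (H' z Z2).
  set (a := (f z - f z0 - c * (z - z0))%C) in *.
  set (b := (g z - g z0 - c' * (z - z0))%C) in *.
  assert (Hz0 := Cmod_ge_0 (z - z0)%C).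
  set (t := Cmod (z - z0)%C) in *.
  assert (Hdg : Cmod (g z - g z0)%C <= (Cmod c' + K') * t).
  { replace (g z - g z0)%C with (c' * (z - z0) + b)%C by (unfold b; ring).
    eapply Rle_trans; [apply Cmod_triangle|]. rewrite Cmod_mult. fold t.
    assert (K' * t ^ 2 <= K' * t) by (apply Rmult_le_compat_l; nra). lra. }
  assert (Hg : Cmod (g z) <= Cmod (g z0) + Cmod c' + K').
  { pose proof (Cmod_le_sub (g z) (g z0)). nra. }
  replace (f z * g z - f z0 * g z0 - (c * g z0 + f z0 * c') * (z - z0))%C
    with (a * g z + f z0 * b + c * (z - z0) * (g z - g z0))%C by (unfold a, b; ring).
  eapply Rle_trans; [apply Cmod_triangle|].
  eapply Rle_trans; [apply Rplus_le_compat_r, Cmod_triangle|].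
  rewrite !Cmod_mult. fold t.
  assert (Cmod a * Cmod (g z) <= (K * t ^ 2) * (Cmod (g z0) + Cmod c' + K'))
    by (apply Rmult_le_compat; auto using Cmod_ge_0).
  assert (Cmod (f z0) * Cmod b <= Cmod (f z0) * (K' * t ^ 2))
    by (apply Rmult_le_compat_l; auto).
  assert (Cmod c * t * Cmod (g z - g z0)%C <= Cmod c * t * ((Cmod c' + K') * t))
    by (apply Rmult_le_compat_l; auto; nra).
  nra.
Qed.

Lemma derivative_at_scal (f : C -> C) (z0 c a : C) :
  derivative_at f z0 c -> derivative_at (fun z => a * f z)%C z0 (a * c)%C.
Proof.
  intros (K & d & Hd & HK & H). exists (Cmod a * K), d.
  split; [lra|]. split; [apply Rmult_le_pos; auto using Cmod_ge_0|].
  intros z Hz.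
  replace (a * f z - a * f z0 - a * c * (z - z0))%C
    with (a * (f z - f z0 - c * (z - z0)))%C by ring.
  rewrite Cmod_mult, Rmult_assoc.
  apply Rmult_le_compat_l; auto using Cmod_ge_0.
Qed.

(** The error for the next exponent is [z] times the previous error plus [(k + 1) z0^k (z - z0)^2].
    The factor [s] on the left avoids the natural exponent [k - 1], which would be truncated at
    [k = 0]. *)
Lemma pow_linear_approx (k : nat) (s : R) (z z0 : C) :
  Cmod z <= s -> Cmod z0 <= s ->
  s * Cmod (z ^ S k - z0 ^ S k - RtoC (INR (S k)) * z0 ^ k * (z - z0))%C
  <= INR (S k) ^ 2 * s ^ k * Cmod (z - z0)%C ^ 2.
Proof.
  intros Hz Hz0. assert (Hs : 0 <= s) by (pose proof (Cmod_ge_0 z); lra).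
  pose proof (Cmod_ge_0 (z - z0)%C) as Ht.
  induction k as [|k IH].
  - replace (z ^ 1 - z0 ^ 1 - RtoC (INR 1) * z0 ^ 0 * (z - z0))%C with (RtoC 0)
      by (simpl; ring).
    rewrite Cmod_0, Rmult_0_r. repeat apply Rmult_le_pos; simpl; lra || nra.
  - set (E := (z ^ S k - z0 ^ S k - RtoC (INR (S k)) * z0 ^ k * (z - z0))%C) in *.
    replace (z ^ S (S k) - z0 ^ S (S k) - RtoC (INR (S (S k))) * z0 ^ S k * (z - z0))%C
      with (z * E + RtoC (INR (S k)) * z0 ^ k * ((z - z0) * (z - z0)))%C.
    2: { unfold E. rewrite (S_INR (S k)), RtoC_plus, !Cpow_S. ring. }
    set (t := Cmod (z - z0)%C) in *. set (n := INR (S k)) in *.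
    rewrite (S_INR (S k)). fold n.
    assert (Hn : 0 <= n) by apply pos_INR.
    assert (Hsk : 0 <= s ^ k) by now apply pow_le.
    eapply Rle_trans; [apply Rmult_le_compat_l; [easy|apply Cmod_triangle]|].
    rewrite !Cmod_mult, Cmod_R, Cmod_pow, (Rabs_pos_eq n) by easy. fold t.
    assert (H1 : s * (Cmod z * Cmod E) <= s * (n ^ 2 * s ^ k * t ^ 2)).
    { replace (s * (Cmod z * Cmod E)) with (Cmod z * (s * Cmod E)) by ring.
      apply Rmult_le_compat; auto using Cmod_ge_0.
      apply Rmult_le_pos; auto using Cmod_ge_0. }
    assert (H2 : s * (n * Cmod z0 ^ k * (t * t)) <= s * (n * s ^ k * (t * t))).
    { apply Rmult_le_compat_l; [easy|]. apply Rmult_le_compat_r; [nra|].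
      apply Rmult_le_compat_l; [easy|]. apply pow_incr. split; [apply Cmod_ge_0|easy]. }
    assert (H3 : 0 <= (n + 1) * (s * s ^ k * t ^ 2)).
    { repeat apply Rmult_le_pos; nra. }
    rewrite Rmult_plus_distr_l. cbn [pow] in *. nra.
Qed.

Lemma derivative_at_pow (k : nat) (z0 : C) :
  derivative_at (fun z => z ^ S k)%C z0 (RtoC (INR (S k)) * z0 ^ k)%C.
Proof.
  set (s := Cmod z0 + 1). pose proof (Cmod_ge_0 z0) as H0.
  assert (Hs : 0 < s) by (unfold s; lra).
  exists (INR (S k) ^ 2 * s ^ k / s), 1. split; [lra|]. split.
  { apply Rdiv_le_0_compat; [|easy]. apply Rmult_le_pos; [apply pow2_ge_0|apply pow_le; lra]. }
  intros z Hz. pose proof (Cmod_le_sub z z0).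
  pose proof (pow_linear_approx k s z z0 ltac:(unfold s; lra) ltac:(unfold s; lra)).
  apply Rmult_le_reg_l with s; [easy|].
  replace (s * (INR (S k) ^ 2 * s ^ k / s * Cmod (z - z0)%C ^ 2))
    with (INR (S k) ^ 2 * s ^ k * Cmod (z - z0)%C ^ 2) by (field; lra).
  easy.
Qed.

(** * Finite Taylor expansions *)

(* [jet n f z0]: f is a polynomial of degree < n in z - z0 up to an error
   O((z - z0)^n), presented by repeated exact division by z - z0. *)
Fixpoint jet (n : nat) (f : C -> C) (z0 : C) : Prop :=
  match n with
  | O => exists K d : R, 0 < d /\ forall z, Cmod (z - z0)%C < d -> Cmod (f z) <= K
  | S n' => exists (g : C -> C) (d : R), 0 < d /\
      (forall z, Cmod (z - z0)%C < d -> f z = (f z0 + (z - z0) * g z)%C) /\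
      jet n' g z0
  end.

Lemma jet_pred (n : nat) (f : C -> C) (z0 : C) : jet (S n) f z0 -> jet n f z0.
Proof.
  revert f; induction n as [|n IH]; intros f (g & d & Hd & Hf & Hg).
  - destruct Hg as (K & d' & Hd' & HK).
    exists (Cmod (f z0) + d * K), (Rmin d d'). split; [apply Rmin_glb_lt; lra|].
    intros z Hz. pose proof (Rmin_l d d'); pose proof (Rmin_r d d').
    rewrite (Hf z) by lra.
    eapply Rle_trans; [apply Cmod_triangle|]. rewrite Cmod_mult.
    apply Rplus_le_compat_l, Rmult_le_compat; auto using Cmod_ge_0; try lra.
    apply HK; lra.
  - exists g, d; auto.
Qed.

Lemma jet_ext (n : nat) (f g : C -> C) (z0 : C) (d : R) :
  0 < d -> (forall z, Cmod (z - z0)%C < d -> f z = g z) -> jet n f z0 -> jet n g z0.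
Proof.
  intros Hd E. assert (E0 : f z0 = g z0) by (apply E; rewrite Cmod_sub_diag; lra).
  destruct n as [|n].
  - intros (K & d' & Hd' & H). exists K, (Rmin d d').
    split; [apply Rmin_glb_lt; lra|]. intros z Hz.
    pose proof (Rmin_l d d'); pose proof (Rmin_r d d').
    rewrite <- E by lra. apply H; lra.
  - intros (h & d' & Hd' & H & Hh). exists h, (Rmin d d').
    split; [apply Rmin_glb_lt; lra|]. split; [|exact Hh]. intros z Hz.
    pose proof (Rmin_l d d'); pose proof (Rmin_r d d').
    rewrite <- E, <- E0 by lra. apply H; lra.
Qed.

Lemma jet_const (n : nat) (c z0 : C) : jet n (fun _ => c) z0.
Proof.
  revert c; induction n as [|n IH]; intros c.
  - exists (Cmod c), 1; split; [lra|]; intros; lra.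
  - exists (fun _ => 0%C), 1; split; [lra|]; split; [intros; ring|apply IH].
Qed.

Lemma jet_id (n : nat) (z0 : C) : jet n (fun z => z) z0.
Proof.
  apply jet_pred.
  exists (fun _ => 1%C), 1; split; [lra|]; split; [intros; ring|apply jet_const].
Qed.

Lemma jet_plus (n : nat) (f g : C -> C) (z0 : C) :
  jet n f z0 -> jet n g z0 -> jet n (fun z => f z + g z)%C z0.
Proof.
  revert f g; induction n as [|n IH]; intros f g.
  - intros (K & d & Hd & H) (K' & d' & Hd' & H'). exists (K + K'), (Rmin d d').
    split; [apply Rmin_glb_lt; lra|]. intros z Hz.
    pose proof (Rmin_l d d'); pose proof (Rmin_r d d').
    eapply Rle_trans; [apply Cmod_triangle|].
    apply Rplus_le_compat; [apply H|apply H']; lra.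
  - intros (h & d & Hd & H & Hh) (h' & d' & Hd' & H' & Hh').
    exists (fun z => h z + h' z)%C, (Rmin d d').
    split; [apply Rmin_glb_lt; lra|]. split; [|now apply IH]. intros z Hz.
    pose proof (Rmin_l d d'); pose proof (Rmin_r d d').
    rewrite (H z), (H' z) by lra. ring.
Qed.

Lemma jet_mult (n : nat) (f g : C -> C) (z0 : C) :
  jet n f z0 -> jet n g z0 -> jet n (fun z => f z * g z)%C z0.
Proof.
  revert f g; induction n as [|n IH]; intros f g Jf Jg.
  - destruct Jf as (K & d & Hd & H); destruct Jg as (K' & d' & Hd' & H').
    exists (K * K'), (Rmin d d').
    split; [apply Rmin_glb_lt; lra|]. intros z Hz.
    pose proof (Rmin_l d d'); pose proof (Rmin_r d d').
    rewrite Cmod_mult. apply Rmult_le_compat; auto using Cmod_ge_0.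
    + apply H; lra.
    + apply H'; lra.
  (* In [f g - f0 g0 = f0 (g - g0) + (f - f0) g] the last factor stays undivided, so [g] is used one
     order lower. *)
  - pose proof (jet_pred _ _ _ Jg) as Jg'.
    destruct Jf as (h & d & Hd & H & Hh); destruct Jg as (h' & d' & Hd' & H' & Hh').
    exists (fun z => f z0 * h' z + h z * g z)%C, (Rmin d d').
    split; [apply Rmin_glb_lt; lra|]. split.
    + intros z Hz. pose proof (Rmin_l d d'); pose proof (Rmin_r d d').
      rewrite (H z) by lra.
      transitivity (f z0 * g z + (z - z0) * h z * g z)%C; [ring|].
      rewrite (H' z) at 1 by lra. ring.
    + apply jet_plus; apply IH; auto. apply jet_const.
Qed.

Lemma jet_lipschitz (n : nat) (f : C -> C) (z0 : C) : jet (S n) f z0 ->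
  exists K d : R, 0 < d /\ 0 <= K /\
    forall z, Cmod (z - z0)%C < d -> Cmod (f z - f z0)%C <= K * Cmod (z - z0)%C.
Proof.
  induction n as [|n IH].
  - intros (g & d & Hd & H & (K & d' & Hd' & HK)).
    exists (Rmax K 0), (Rmin d d').
    split; [apply Rmin_glb_lt; lra|]. split; [apply Rmax_r|].
    intros z Hz. pose proof (Rmin_l d d'); pose proof (Rmin_r d d').
    rewrite (H z) by lra.
    replace (f z0 + (z - z0) * g z - f z0)%C with (g z * (z - z0))%C by ring.
    rewrite Cmod_mult. apply Rmult_le_compat_r; auto using Cmod_ge_0.
    eapply Rle_trans; [apply HK; lra|apply Rmax_l].
  - intros J; apply IH; now apply jet_pred.
Qed.

(** The order starts at 1 because mere boundedness does not keep [f] away from 0, whereas the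
    Lipschitz bound does. The next quotient comes from [1/f - 1/f0 = -(f - f0) / (f0 f)]. *)
Lemma jet_inv (n : nat) (f : C -> C) (z0 : C) :
  jet (S n) f z0 -> f z0 <> 0%C -> jet (S n) (fun z => / f z)%C z0.
Proof.
  intros J H0.
  destruct (jet_lipschitz _ _ _ J) as (K & d & Hd & HK & HL).
  assert (M0 : 0 < Cmod (f z0)) by now apply Cmod_gt_0.
  assert (Hfar : exists r, 0 < r /\
            forall z, Cmod (z - z0)%C < r -> Cmod (f z0) / 2 <= Cmod (f z)).
  { exists (Rmin d (Cmod (f z0) / (2 * (K + 1)))).
    assert (0 < Cmod (f z0) / (2 * (K + 1))) by (apply Rdiv_lt_0_compat; lra).
    split; [apply Rmin_glb_lt; lra|]. intros z Hz.
    pose proof (Rmin_l d (Cmod (f z0) / (2 * (K + 1)))).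
    pose proof (Rmin_r d (Cmod (f z0) / (2 * (K + 1)))).
    specialize (HL z ltac:(lra)).
    pose proof (Cmod_le_sub (f z0) (f z)) as T. rewrite Cmod_sub_sym in T.
    assert (K * Cmod (z - z0)%C <= (K + 1) * (Cmod (f z0) / (2 * (K + 1)))).
    { apply Rmult_le_compat; auto using Cmod_ge_0; lra. }
    replace ((K + 1) * (Cmod (f z0) / (2 * (K + 1)))) with (Cmod (f z0) / 2) in *
      by (field; lra). lra. }
  destruct Hfar as (r & Hr & Hfar).
  assert (Hnz : forall z, Cmod (z - z0)%C < r -> f z <> 0%C).
  { intros z Hz; apply Cmod_gt_0. specialize (Hfar z Hz); lra. }
  assert (J0 : jet 0 (fun z => / f z)%C z0).
  { exists (/ (Cmod (f z0) / 2)), r. split; [lra|]. intros z Hz.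
    rewrite Cmod_inv by auto. apply Rinv_le_contravar; [lra|auto]. }
  clear HL HK Hfar M0.
  (* With the nonvanishing radius [r] fixed, the induction can start at order 0. *)
  assert (Gen : forall m, jet m f z0 -> jet m (fun z => / f z)%C z0); [|now apply Gen].
  clear J. induction m as [|m IH]; [auto|]. intros J.
  pose proof (IH (jet_pred _ _ _ J)) as IH'.
  destruct J as (g & e & He & Hg & Jg).
  exists (fun z => - (/ f z0) * (g z * / f z))%C, (Rmin e r).
  split; [apply Rmin_glb_lt; lra|]. split.
  - intros z Hz. pose proof (Rmin_l e r); pose proof (Rmin_r e r).
    assert (f z <> 0%C) by (apply Hnz; lra).
    transitivity (/ f z0 + - (/ f z0) * ((f z - f z0) * / f z))%C; [field; auto|].
    rewrite (Hg z) at 1 by lra. ring.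
  - apply jet_mult; [apply jet_const|]. now apply jet_mult.
Qed.

(** The quotient stored in a jet is determined only near [z0]. Elsewhere it is replaced by the true
    difference quotient, so that a single [h] can be studied over the whole disc. *)
Lemma jet_derivative (n : nat) (f : C -> C) (z0 : C) : jet (S (S n)) f z0 ->
  exists h : C -> C,
    (forall z, z <> z0 -> h z = ((f z - f z0) / (z - z0))%C) /\
    jet (S n) h z0 /\ derivative_at f z0 (h z0).
Proof.
  intros (g & d & Hd & Hf & Hg).
  set (h := fun z => if excluded_middle_informative (z = z0) then g z0
                     else ((f z - f z0) / (z - z0))%C).
  assert (Hgh : forall z, Cmod (z - z0)%C < d -> g z = h z).
  { intros z Hz. unfold h. destruct excluded_middle_informative as [->|Hne]; [easy|].
    rewrite (Hf z) by auto. field.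
    apply Cmod_gt_0. now apply Cmod_sub_gt_0. }
  exists h. split; [|split].
  - intros z Hz. unfold h. destruct excluded_middle_informative; [easy|reflexivity].
  - now apply (jet_ext _ g _ _ d).
  - destruct (jet_lipschitz _ _ _ Hg) as (K & d' & Hd' & HK & H).
    exists K, (Rmin d d'). split; [apply Rmin_glb_lt; lra|]. split; [easy|].
    intros z Hz. pose proof (Rmin_l d d'); pose proof (Rmin_r d d').
    rewrite (Hf z), <- Hgh by (rewrite ?Cmod_sub_diag; lra).
    replace (f z0 + (z - z0) * g z - f z0 - g z0 * (z - z0))%C
      with ((g z - g z0) * (z - z0))%C by ring.
    rewrite Cmod_mult. specialize (H z ltac:(lra)).
    pose proof (Cmod_ge_0 (z - z0)%C). nra.
Qed.

Lemma is_series_terms_bounded (u : nat -> C) (l : C) :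
  is_series u l -> exists M, 0 <= M /\ forall n, Cmod (u n) <= M.
Proof.
  intros H.
  destruct (filterlim_bounded (K := C_AbsRing) (V := C_NormedModule) (sum_n u)) as [M HM].
  { now exists l. }
  change (forall n, Cmod (sum_n u n) <= M) in HM.
  assert (HM0 : 0 <= M) by (eapply Rle_trans; [apply Cmod_ge_0|apply (HM O)]).
  exists (M + M). split; [lra|]. intros n.
  destruct n as [|n].
  - specialize (HM O). rewrite sum_O in HM. lra.
  - pose proof (HM n) as H1; pose proof (HM (S n)) as H2.
    rewrite sum_Sn in H2.
    set (s := sum_n u n) in *.
    change (plus s (u (S n))) with (s + u (S n))%C in H2.
    replace (u (S n)) with ((s + u (S n)) - s)%C by ring.
    unfold Cminus. eapply Rle_trans; [apply Cmod_triangle|]. rewrite Cmod_opp; lra.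
Qed.

Lemma Cpow_pow_n (z : C) (n : nat) : pow_n (K := C_AbsRing) z n = (z ^ n)%C.
Proof.
  induction n as [|n IH]; [reflexivity|]. cbn [pow_n]. rewrite IH, Cpow_S. reflexivity.
Qed.

(** Removing the constant term and dividing by [z - z0] shifts the coefficients, so the induction
    stays within power series and only local boundedness requires an estimate. *)
Lemma pseries_jet (n : nat) (c : nat -> C) (f : C -> C) (z0 : C) (rho : R) :
  0 < rho ->
  (forall z, Cmod (z - z0)%C < rho -> is_pseries c (z - z0)%C (f z)) ->
  jet n f z0.
Proof.
  intros Hrho; revert c f; induction n as [|n IH]; intros c f H.
  (* Terms are bounded by [M] at distance [s]; within [s / 2] they are dominated by [M / 2^k], so
     partial sums stay below [2 M]. *)
  - set (s := rho / 2).
    assert (Es : (z0 + RtoC s - z0)%C = RtoC s) by ring.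
    assert (Ms : Cmod (RtoC s) = s) by (rewrite Cmod_R, Rabs_pos_eq; unfold s; lra).
    destruct (is_series_terms_bounded _ _
                (H (z0 + RtoC s)%C ltac:(rewrite Es, Ms; unfold s; lra))) as (M & HM0 & HM).
    rewrite Es in HM.
    assert (HM' : forall k, Cmod (c k) * s ^ k <= M).
    { intros k. specialize (HM k).
      change (scal (pow_n (RtoC s) k) (c k)) with ((pow_n (K := C_AbsRing) (RtoC s) k) * c k)%C in HM.
      rewrite Cpow_pow_n, Cmod_mult, Cmod_pow, Ms in HM. lra. }
    exists (2 * M + 1), (s / 2). split; [unfold s; lra|]. intros z Hz.
    specialize (H z ltac:(unfold s in *; lra)).
    assert (Hsum : forall N, Cmod (sum_n (fun k => scal (pow_n (z - z0)%C k) (c k)) N)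
                     <= M * (2 - (/ 2) ^ N)).
    { assert (Ht : forall k, Cmod (scal (pow_n (z - z0)%C k) (c k)) <= M * (/ 2) ^ k).
      { intros k.
        change (scal (pow_n (z - z0)%C k) (c k))
          with ((pow_n (K := C_AbsRing) (z - z0)%C k) * c k)%C.
        rewrite Cpow_pow_n, Cmod_mult, Cmod_pow.
        apply Rle_trans with ((s * / 2) ^ k * Cmod (c k)).
        - apply Rmult_le_compat_r; [apply Cmod_ge_0|].
          apply pow_incr; split; [apply Cmod_ge_0|lra].
        - rewrite Rpow_mult_distr. specialize (HM' k).
          assert (0 < (/ 2) ^ k) by (apply pow_lt; lra). nra. }
      induction N as [|N IHN].
      - rewrite sum_O. specialize (Ht O). simpl in Ht |- *. lra.
      - rewrite sum_Sn.
        eapply Rle_trans; [apply Cmod_triangle|].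
        specialize (Ht (S N)). cbn [pow] in Ht |- *.
        eapply Rle_trans; [apply Rplus_le_compat; [exact IHN|exact Ht]|]. lra. }
    (* Balls of [C] are coordinatewise, hence the [sqrt 2]; tolerance 1/2 keeps the error below 1,
       which is the [+ 1] in the bound. *)
    destruct (proj1 (filterlim_locally (F := eventually) _ _) H (mkposreal (/ 2) ltac:(lra)))
      as [N HN].
    specialize (HN N (Nat.le_refl _)).
    apply C_NormedModule_mixin_compat2 in HN. simpl in HN.
    change minus with Cminus in HN.
    specialize (Hsum N).
    assert (sqrt 2 < 2) by (rewrite <- (sqrt_square 2) at 2 by lra; apply sqrt_lt_1; lra).
    pose proof (Cmod_le_sub (f z) (sum_n (fun k => scal (pow_n (z - z0)%C k) (c k)) N)) as T.
    rewrite Cmod_sub_sym in T.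
    assert (0 < (/ 2) ^ N) by (apply pow_lt; lra).
    set (S0 := sum_n (fun k => scal (pow_n (z - z0)%C k) (c k)) N) in *.
    assert (Cmod (S0 - f z)%C < sqrt 2 * / 2) by exact HN.
    nra.
  - assert (Hc0 : f z0 = c O).
    { assert (H0 := H z0 ltac:(rewrite Cmod_sub_diag; lra)).
      replace (z0 - z0)%C with (RtoC 0) in H0 by ring.
      assert (H0' : is_pseries (K := C_AbsRing) (V := C_NormedModule) c (RtoC 0) (c O))
        by exact (is_pseries_0 (K := C_AbsRing) (V := C_NormedModule) c).
      exact (filterlim_locally_unique _ _ _ H0 H0'). }
    set (g := fun z => if excluded_middle_informative (z = z0) then c 1%nat
                       else ((f z - c O) / (z - z0))%C).
    exists g, rho. split; [lra|]. split.
    + intros z Hz. unfold g. destruct excluded_middle_informative as [->|Hne]; [ring|].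
      rewrite Hc0. field. apply Cmod_gt_0. now apply Cmod_sub_gt_0.
    + apply (IH (PS_decr_1 c)). intros z Hz. unfold g.
      destruct excluded_middle_informative as [->|Hne].
      * replace (z0 - z0)%C with (RtoC 0) by ring.
        exact (is_pseries_0 (K := C_AbsRing) (V := C_NormedModule) (PS_decr_1 c)).
      * assert (Hnz : (z - z0)%C <> 0%C) by (apply Cmod_gt_0; now apply Cmod_sub_gt_0).
        replace ((f z - c O) / (z - z0))%C with (/ (z - z0) * (f z - c O))%C by (field; auto).
        apply (is_pseries_decr_1 (K := C_AbsRing) (V := C_NormedModule) c (z - z0)%C (/ (z - z0))%C (f z)); [|auto].
        change (/ (z - z0) * (z - z0) = 1)%C. field; auto.
Qed.

Lemma analytic_jet (f : C -> C) (z0 : C) (n : nat) : analytic_at f z0 -> jet n f z0.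
Proof.
  intros (c & rho & Hrho & H). now apply (pseries_jet n c f z0 rho).
Qed.

(** * The maximum principle *)

(** Compactness of the enclosing square supplies a positive lower bound for the local sizes, and it
    works everywhere since [Q] survives shrinking [d]. *)
Lemma closed_disc_compact (rho : R) (Q : R -> C -> Prop) :
  (forall d d' z, d <= d' -> Q d' z -> Q d z) ->
  (forall z0, Cmod z0 <= rho -> exists d, 0 < d /\
     forall z, Cmod (z - z0)%C < d -> Cmod z <= rho -> Q d z) ->
  exists d, 0 < d /\ forall z, Cmod z <= rho -> Q d z.
Proof.
  intros Qmon Hloc.
  (* Points of the square outside the disc get a neighbourhood that misses the disc. The 2 is the
     loss from coordinates to modulus through [|Re| + |Im|]. *)
  assert (Hall : forall z0 : C, exists d : posreal,
            forall z, Cmod (z - z0)%C < 2 * d -> Cmod z <= rho -> Q d z).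
  { intros z0. destruct (Rle_lt_dec (Cmod z0) rho) as [Hz0|Hz0].
    - destruct (Hloc z0 Hz0) as (d & Hd & H).
      exists (mkposreal (d / 2) ltac:(lra)). cbn. intros z Hz Hz'.
      apply Qmon with d; [lra|]. apply H; lra.
    - exists (mkposreal ((Cmod z0 - rho) / 2) ltac:(lra)). cbn. intros z Hz Hz'.
      pose proof (Cmod_le_sub z0 z) as T. rewrite Cmod_sub_sym in T. lra. }
  destruct (choice _ Hall) as [del Hdel].
  destruct (compactness_value_2d (- rho) rho (- rho) rho (fun x y => del (x, y)))
    as [d Hd].
  exists d. split; [apply cond_pos|]. intros z Hz.
  pose proof (Rmax_Cmod z) as Hm.
  pose proof (Rmax_l (Rabs (fst z)) (Rabs (snd z))) as Hml.
  pose proof (Rmax_r (Rabs (fst z)) (Rabs (snd z))) as Hmr.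
  specialize (Hd (fst z) (snd z)).
  apply NNPP in Hd; [|apply Rabs_le_between; lra|apply Rabs_le_between; lra].
  destruct Hd as (a & b & _ & _ & Ha & Hb & Hle).
  apply Qmon with (del (a, b)); [easy|]. apply Hdel; [|easy].
  eapply Rle_lt_trans; [apply Cmod_le_abs_Re_Im|].
  change (Rabs (fst z + - a) + Rabs (snd z + - b) < 2 * del (a, b)).
  change (fst z + - a) with (fst z - a). change (snd z + - b) with (snd z - b).
  lra.
Qed.

Lemma closed_disc_max (rho : R) (u : C -> R) :
  0 <= rho ->
  (forall z0, Cmod z0 <= rho -> forall e, 0 < e -> exists d, 0 < d /\
     forall z, Cmod (z - z0)%C < d -> Rabs (u z - u z0) < e) ->
  exists z1, Cmod z1 <= rho /\ forall z, Cmod z <= rho -> u z <= u z1.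
Proof.
  intros Hrho Hu.
  (* Boundedness is made a shrinkable property: [u z <= / d] weakens as [d] decreases. *)
  destruct (closed_disc_compact rho (fun d z => 0 < d -> u z <= / d)) as (d & Hd & Hbd).
  { intros d d' z Hdd H Hd. apply Rle_trans with (/ d'); [apply H; lra|].
    now apply Rinv_le_contravar. }
  { intros z0 Hz0. destruct (Hu z0 Hz0 1 ltac:(lra)) as (d & Hd & H).
    pose proof (Rabs_pos (u z0)) as Hpos.
    assert (0 < / (Rabs (u z0) + 1)) by (apply Rinv_0_lt_compat; lra).
    exists (Rmin d (/ (Rabs (u z0) + 1))). split; [now apply Rmin_glb_lt|].
    intros z Hz _ Hm.
    pose proof (Rmin_l d (/ (Rabs (u z0) + 1))).
    pose proof (Rmin_r d (/ (Rabs (u z0) + 1))).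
    specialize (H z ltac:(lra)). apply Rabs_def2 in H; destruct H.
    apply Rle_trans with (Rabs (u z0) + 1).
    - pose proof (Rle_abs (u z0)); lra.
    - apply Rle_trans with (/ / (Rabs (u z0) + 1)); [rewrite Rinv_inv; lra|].
      now apply Rinv_le_contravar. }
  destruct (completeness (fun y => exists z, Cmod z <= rho /\ y = u z)) as [M [HM1 HM2]].
  { exists (/ d). intros y (z & Hz & ->). now apply Hbd. }
  { exists (u 0%C), 0%C. rewrite Cmod_0. auto. }
  apply NNPP; intros Hno.
  assert (Hlt : forall z, Cmod z <= rho -> u z < M).
  { intros z Hz. destruct (Rle_lt_or_eq_dec (u z) M) as [|E]; [apply HM1; eauto|auto|].
    exfalso; apply Hno. exists z; split; [auto|]. intros z' Hz'. rewrite E. apply HM1; eauto. }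
  (* If the supremum [M] were not attained, a uniform gap [d2] would contradict its minimality. *)
  destruct (closed_disc_compact rho (fun d z => u z <= M - d)) as (d2 & Hd2 & H2).
  { intros; lra. }
  { intros z0 Hz0. pose proof (Hlt z0 Hz0).
    destruct (Hu z0 Hz0 ((M - u z0) / 2) ltac:(lra)) as (e & He & He').
    exists (Rmin e ((M - u z0) / 2)). split; [apply Rmin_glb_lt; lra|].
    intros z Hz _.
    pose proof (Rmin_l e ((M - u z0) / 2)). pose proof (Rmin_r e ((M - u z0) / 2)).
    specialize (He' z ltac:(lra)). apply Rabs_def2 in He'. lra. }
  assert (M <= M - d2); [|lra].
  apply HM2. intros y (z & Hz & ->). now apply H2.
Qed.

(* Averaging over the fourth roots of unity annihilates all the mixed terms. *)
Lemma four_point_mean (a b c z0 : C) (t : R) :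
  (Cmod (a + RtoC t * (b + RtoC t * c)) ^ 2
   + Cmod (a + (- RtoC t) * (b + (- RtoC t) * c)) ^ 2
   + Cmod (a + (Ci * RtoC t) * (b + (Ci * RtoC t) * c)) ^ 2
   + Cmod (a + (- (Ci * RtoC t)) * (b + (- (Ci * RtoC t)) * c)) ^ 2
   = 4 * (Cmod a ^ 2 + t ^ 2 * Cmod b ^ 2 + t ^ 4 * Cmod c ^ 2)).
Proof.
  destruct a as [a1 a2], b as [b1 b2], c as [c1 c2].
  rewrite !Cmod2_alt. cbn. ring.
Qed.

(** Order 3 makes the remainder [O(t^3)], which for small [t] loses against the gain [eps t^2] that
    [eps |z|^2] brings to the mean over four points at distance [t]. *)
Lemma no_local_max (h : C -> C) (z0 : C) (eps r : R) :
  jet 3 h z0 -> 0 < eps -> 0 < r ->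
  ~ (forall z, Cmod (z - z0)%C < r ->
       Cmod (h z) ^ 2 + eps * Cmod z ^ 2 <= Cmod (h z0) ^ 2 + eps * Cmod z0 ^ 2).
Proof.
  intros (g1 & d1 & Hd1 & H1 & g2 & d2 & Hd2 & H2 & g3 & d3 & Hd3 & H3 & K0 & d4 & Hd4 & H4)
    Heps Hr Hmax.
  set (a := h z0) in *. set (b := g1 z0) in *. set (c := g2 z0) in *.
  set (K := Rmax K0 0).
  assert (HK : 0 <= K) by apply Rmax_r.
  set (P := fun w : C => (a + w * (b + w * c))%C).
  set (q := Cmod a + (Cmod b + Cmod c)).
  assert (Ha := Cmod_ge_0 a). assert (Hb := Cmod_ge_0 b). assert (Hc := Cmod_ge_0 c).
  (* [|P|^2 - |h|^2] factors as a difference of at most [K t^3] times a sum of at most [2 q + K]. *)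
  set (L := K * (2 * q + K)).
  assert (HL : 0 <= L) by (apply Rmult_le_pos; unfold q; lra).
  assert (Ht : exists t, 0 < t /\ t < 1 /\ t < r /\ t < d1 /\ t < d2 /\ t < d3 /\ t < d4
                         /\ L * t < eps).
  { set (m := Rmin (Rmin (Rmin 1 r) (Rmin d1 d2)) (Rmin (Rmin d3 d4) (eps / (L + 1)))).
    assert (He : 0 < eps / (L + 1)) by (apply Rdiv_lt_0_compat; lra).
    assert (Hm : 0 < m) by (unfold m; repeat apply Rmin_glb_lt; lra).
    assert (m <= 1 /\ m <= r /\ m <= d1 /\ m <= d2 /\ m <= d3 /\ m <= d4 /\ m <= eps / (L + 1))
      as (M1 & M2 & M3 & M4 & M5 & M6 & M7).
    { assert (Hl : forall x y w, w <= Rmin x y -> w <= x /\ w <= y).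
      { intros x y w Hw. pose proof (Rmin_l x y); pose proof (Rmin_r x y); lra. }
      destruct (Hl _ _ m (Rle_refl _)) as [Ma Mb].
      apply Hl in Ma; destruct Ma as [Ma Ma']. apply Hl in Mb; destruct Mb as [Mb Mb'].
      apply Hl in Ma, Ma', Mb. tauto. }
    assert (L * m <= eps).
    { apply Rle_trans with ((L + 1) * (eps / (L + 1))).
      - apply Rmult_le_compat; lra.
      - right; field; lra. }
    exists (m / 2). repeat split; lra. }
  destruct Ht as (t & Ht0 & Ht1 & Htr & Htd1 & Htd2 & Htd3 & Htd4 & HLt).
  assert (Hpt : forall w : C, Cmod w = t ->
            Cmod (P w) ^ 2 - L * t ^ 3 + eps * Cmod (z0 + w)%C ^ 2
            <= Cmod a ^ 2 + eps * Cmod z0 ^ 2).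
  { intros w Hw.
    assert (Ew : (z0 + w - z0)%C = w) by ring.
    specialize (H1 (z0 + w)%C). specialize (H2 (z0 + w)%C). specialize (H3 (z0 + w)%C).
    specialize (H4 (z0 + w)%C). specialize (Hmax (z0 + w)%C).
    rewrite Ew, Hw in *.
    specialize (Hmax Htr). specialize (H1 Htd1). specialize (H2 Htd2).
    specialize (H3 Htd3). specialize (H4 Htd4).
    assert (HR : Cmod (g3 (z0 + w)%C) <= K) by (eapply Rle_trans; [exact H4|apply Rmax_l]).
    assert (Eh : (h (z0 + w) - P w = w * w * w * g3 (z0 + w))%C).
    { rewrite H1, H2. unfold P. fold c. rewrite H3. ring. }
    assert (Hdiff : Cmod (h (z0 + w) - P w)%C <= K * t ^ 3).
    { rewrite Eh, !Cmod_mult, Hw.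
      replace (K * t ^ 3) with (t * t * t * K) by ring.
      apply Rmult_le_compat_l; [nra|easy]. }
    assert (HP : Cmod (P w) <= q).
    { unfold P, q. eapply Rle_trans; [apply Cmod_triangle|]. apply Rplus_le_compat_l.
      rewrite Cmod_mult, Hw.
      assert (Cmod (b + w * c)%C <= Cmod b + Cmod c).
      { eapply Rle_trans; [apply Cmod_triangle|]. rewrite Cmod_mult, Hw. nra. }
      pose proof (Cmod_ge_0 (b + w * c)%C). nra. }
    pose proof (Cmod_le_sub (h (z0 + w)%C) (P w)) as T1.
    pose proof (Cmod_le_sub (P w) (h (z0 + w)%C)) as T2. rewrite Cmod_sub_sym in T2.
    pose proof (Cmod_ge_0 (P w)). pose proof (Cmod_ge_0 (h (z0 + w)%C)).
    assert (0 < t ^ 3 <= 1).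
    { split; [apply pow_lt; lra|]. rewrite <- (pow1 3). apply pow_incr; lra. }
    assert (Cmod (P w) ^ 2 - Cmod (h (z0 + w)%C) ^ 2 <= L * t ^ 3); [|lra].
    set (x := Cmod (P w)) in *. set (y := Cmod (h (z0 + w)%C)) in *.
    replace (x ^ 2 - y ^ 2) with ((x - y) * (x + y)) by ring.
    apply Rle_trans with ((K * t ^ 3) * (2 * q + K)); [|unfold L; right; ring].
    apply Rle_trans with ((K * t ^ 3) * (x + y)).
    - apply Rmult_le_compat_r; lra.
    - assert (K * t ^ 3 <= K) by nra.
      apply Rmult_le_compat_l; [apply Rmult_le_pos|]; lra. }
  assert (Mt : Cmod (RtoC t) = t) by (rewrite Cmod_R, Rabs_pos_eq; lra).
  assert (Mi : Cmod (Ci * RtoC t)%C = t) by (rewrite Cmod_mult, Cmod_Ci, Mt; ring).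
  pose proof (Hpt (RtoC t) Mt) as P1.
  pose proof (Hpt (- RtoC t)%C ltac:(now rewrite Cmod_opp)) as P2.
  pose proof (Hpt (Ci * RtoC t)%C Mi) as P3.
  pose proof (Hpt (- (Ci * RtoC t))%C ltac:(now rewrite Cmod_opp)) as P4.
  pose proof (four_point_mean a b c z0 t) as E1.
  (* For [z0 + w] the four squares sum to exactly [4 (|z0|^2 + t^2)], the source of the strict
     gain. *)
  pose proof (four_point_mean z0 1%C 0%C z0 t) as E2.
  replace (z0 + RtoC t * (1 + RtoC t * 0))%C with (z0 + RtoC t)%C in E2 by ring.
  replace (z0 + - RtoC t * (1 + - RtoC t * 0))%C with (z0 + - RtoC t)%C in E2 by ring.
  replace (z0 + Ci * RtoC t * (1 + Ci * RtoC t * 0))%C with (z0 + Ci * RtoC t)%C in E2 by ring.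
  replace (z0 + - (Ci * RtoC t) * (1 + - (Ci * RtoC t) * 0))%C
    with (z0 + - (Ci * RtoC t))%C in E2 by ring.
  rewrite Cmod_1, Cmod_0 in E2.
  fold (P (RtoC t)) (P (- RtoC t)%C) (P (Ci * RtoC t)%C) (P (- (Ci * RtoC t))%C) in E1.
  assert (0 <= t ^ 2 * Cmod b ^ 2) by (apply Rmult_le_pos; apply pow2_ge_0).
  assert (0 <= t ^ 4 * Cmod c ^ 2)
    by (apply Rmult_le_pos; [apply pow_le; lra|apply pow2_ge_0]).
  assert (Hfin : eps * t ^ 2 <= L * t ^ 3).
  { apply (f_equal (Rmult eps)) in E2. lra. }
  assert (0 < t ^ 2) by (apply pow_lt; lra).
  replace (L * t ^ 3) with ((L * t) * t ^ 2) in Hfin by ring.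
  nra.
Qed.

Lemma maximum_principle (h : C -> C) (rho M : R) :
  0 < rho -> 0 <= M ->
  (forall z, Cmod z <= rho -> jet 3 h z) ->
  (forall z, Cmod z = rho -> Cmod (h z) ^ 2 <= M) ->
  forall z, Cmod z <= rho -> Cmod (h z) ^ 2 <= M.
Proof.
  intros Hrho HM Hj Hbd z1 Hz1.
  destruct (Rle_lt_dec (Cmod (h z1) ^ 2) M) as [|Hgt]; [easy|exfalso].
  assert (He : exists eps, 0 < eps /\ M + eps * rho ^ 2 < Cmod (h z1) ^ 2).
  (* [eps rho^2] is half the excess over [M], so the perturbed function is larger at [z1] than
     anywhere on the circle and its maximum is interior. *)
  { exists ((Cmod (h z1) ^ 2 - M) / (2 * rho ^ 2)).
    assert (0 < rho ^ 2) by (apply pow_lt; lra).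
    split; [apply Rdiv_lt_0_compat; lra|].
    replace ((Cmod (h z1) ^ 2 - M) / (2 * rho ^ 2) * rho ^ 2)
      with ((Cmod (h z1) ^ 2 - M) / 2) by (field; lra). lra. }
  destruct He as (eps & Heps & Hlt).
  destruct (closed_disc_max rho (fun z => Cmod (h z) ^ 2 + eps * Cmod z ^ 2))
    as (zm & Hzm & Hmax); [lra| |].
  { intros z0 Hz0 e He.
    destruct (jet_lipschitz _ _ _ (Hj z0 Hz0)) as (K & d & Hd & HK & HL).
    set (A := K * (2 * Cmod (h z0) + K) + eps * (2 * Cmod z0 + 1)).
    pose proof (Cmod_ge_0 (h z0)). pose proof (Cmod_ge_0 z0).
    assert (HA : 0 <= A).
    { unfold A. assert (0 <= K * (2 * Cmod (h z0) + K)) by (apply Rmult_le_pos; lra).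
      assert (0 <= eps * (2 * Cmod z0 + 1)) by (apply Rmult_le_pos; lra). lra. }
    assert (0 < e / (A + 1)) by (apply Rdiv_lt_0_compat; lra).
    exists (Rmin (Rmin d 1) (e / (A + 1))).
    split; [repeat apply Rmin_glb_lt; lra|]. intros z Hz.
    pose proof (Rmin_l (Rmin d 1) (e / (A + 1))).
    pose proof (Rmin_r (Rmin d 1) (e / (A + 1))).
    pose proof (Rmin_l d 1). pose proof (Rmin_r d 1).
    specialize (HL z ltac:(lra)).
    pose proof (Cmod_ge_0 (z - z0)%C). set (t := Cmod (z - z0)%C) in *.
    assert (Hsq : forall (x y : C) (s : R), Cmod (x - y)%C <= s ->
              Rabs (Cmod x ^ 2 - Cmod y ^ 2) <= s * (2 * Cmod y + s)).
    { intros x y s Hs.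
      pose proof (Cmod_le_sub x y) as T1. pose proof (Cmod_le_sub y x) as T2.
      rewrite Cmod_sub_sym in T2. pose proof (Cmod_ge_0 x). pose proof (Cmod_ge_0 y).
      replace (Cmod x ^ 2 - Cmod y ^ 2) with ((Cmod x - Cmod y) * (Cmod x + Cmod y)) by ring.
      rewrite Rabs_mult. apply Rmult_le_compat; auto using Rabs_pos.
      - apply Rabs_le; lra.
      - rewrite Rabs_pos_eq; lra. }
    pose proof (Hsq _ _ _ HL) as S1.
    pose proof (Hsq z z0 t (Rle_refl _)) as S2.
    assert (B1 : K * t * (2 * Cmod (h z0) + K * t) <= t * (K * (2 * Cmod (h z0) + K))).
    { replace (K * t * (2 * Cmod (h z0) + K * t))
        with (t * (K * (2 * Cmod (h z0) + K * t))) by ring.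
      apply Rmult_le_compat_l; [lra|]. apply Rmult_le_compat_l; [lra|]. nra. }
    assert (B2 : t * (2 * Cmod z0 + t) <= t * (2 * Cmod z0 + 1))
      by (apply Rmult_le_compat_l; lra).
    replace (Cmod (h z) ^ 2 + eps * Cmod z ^ 2 - (Cmod (h z0) ^ 2 + eps * Cmod z0 ^ 2))
      with ((Cmod (h z) ^ 2 - Cmod (h z0) ^ 2) + eps * (Cmod z ^ 2 - Cmod z0 ^ 2)) by ring.
    eapply Rle_lt_trans; [apply Rabs_triang|].
    rewrite Rabs_mult, (Rabs_pos_eq eps) by lra.
    assert (Hfin : t * A < e).
    { apply Rle_lt_trans with (e / (A + 1) * A).
      - apply Rmult_le_compat_r; lra.
      - assert (e / (A + 1) * (A + 1) = e) by (field; lra). lra. }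
    assert (eps * Rabs (Cmod z ^ 2 - Cmod z0 ^ 2) <= eps * (t * (2 * Cmod z0 + 1)))
      by (apply Rmult_le_compat_l; lra).
    unfold A in Hfin. lra. }
  assert (Hzm' : Cmod zm < rho).
  { destruct (Rle_lt_or_eq_dec _ _ Hzm) as [|E]; [easy|exfalso].
    pose proof (Hbd zm E). specialize (Hmax z1 Hz1). cbv beta in Hmax. rewrite E in Hmax.
    assert (0 <= eps * Cmod z1 ^ 2) by (apply Rmult_le_pos; [lra|apply pow2_ge_0]). lra. }
  apply (no_local_max h zm eps (rho - Cmod zm)); [auto|easy|lra|].
  intros z Hz. apply Hmax. pose proof (Cmod_le_sub z zm). lra.
Qed.

(** * Schwarz's lemma and the Schwarz-Pick inequality *)

(** The identity behind Blaschke factors: denominator and numerator differ, in squared modulus, by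
    the product of the defects of [a] and [b]. It serves below both for values of [f] and for the
    points themselves. *)
Lemma Cmod2_one_sub_conj_mult (a b : C) :
  Cmod (1 - Cconj a * b)%C ^ 2
  = Cmod (b - a)%C ^ 2 + (1 - Cmod a ^ 2) * (1 - Cmod b ^ 2).
Proof.
  destruct a as [a1 a2], b as [b1 b2]. rewrite !Cmod2_alt. cbn. ring.
Qed.

Lemma one_sub_conj_mult_neq_0 (a b : C) :
  Cmod a < 1 -> Cmod b <= 1 -> (1 - Cconj a * b)%C <> 0%C.
Proof.
  intros Ha Hb. apply Cmod_gt_0.
  pose proof (Cmod_le_sub 1%C (Cconj a * b)%C) as T.
  rewrite Cmod_mult, Cmod_conj, Cmod_1 in T.
  pose proof (Cmod_ge_0 a). pose proof (Cmod_ge_0 b). nra.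
Qed.

(** This is the limit [rho -> 1] with explicit [rho = 1 - m]: the numerator is at most [2 m] and the
    denominator at least [(1 - r0)^2 / 4], so the 16 in [m] gives a contradiction. The bound [r1]
    keeps a prescribed point inside the circle. *)
Lemma le_1_of_circle_bounds (x r0 r1 : R) :
  0 <= r0 < 1 -> r1 < 1 ->
  (forall rho, r0 < rho < 1 -> r1 <= rho ->
     x <= 1 + (1 - rho ^ 2) / (rho - r0) ^ 2) ->
  x <= 1.
Proof.
  intros Hr0 Hr1 H.
  destruct (Rle_lt_dec x 1) as [|Hx]; [easy|exfalso].
  set (m := Rmin (Rmin ((1 - r0) / 2) (1 - r1)) ((x - 1) * (1 - r0) ^ 2 / 16)).
  assert (Hsq : 0 < (1 - r0) ^ 2) by (apply pow_lt; lra).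
  assert (Hm : 0 < m) by (unfold m; repeat apply Rmin_glb_lt; nra).
  assert (m <= (1 - r0) / 2 /\ m <= 1 - r1 /\ m <= (x - 1) * (1 - r0) ^ 2 / 16)
    as (M1 & M2 & M3).
  { unfold m. pose proof (Rmin_l (Rmin ((1 - r0) / 2) (1 - r1)) ((x - 1) * (1 - r0) ^ 2 / 16)).
    pose proof (Rmin_r (Rmin ((1 - r0) / 2) (1 - r1)) ((x - 1) * (1 - r0) ^ 2 / 16)).
    pose proof (Rmin_l ((1 - r0) / 2) (1 - r1)). pose proof (Rmin_r ((1 - r0) / 2) (1 - r1)).
    lra. }
  specialize (H (1 - m) ltac:(lra) ltac:(lra)).
  assert (Hd : 0 < (1 - m - r0) ^ 2) by (apply pow_lt; lra).
  assert (Hk : (x - 1) * (1 - m - r0) ^ 2 <= 1 - (1 - m) ^ 2).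
  { apply Rle_trans with ((1 - (1 - m) ^ 2) / (1 - m - r0) ^ 2 * (1 - m - r0) ^ 2).
    - apply Rmult_le_compat_r; lra.
    - right; field; lra. }
  assert ((1 - r0) ^ 2 / 4 <= (1 - m - r0) ^ 2) by nra.
  assert ((x - 1) * ((1 - r0) ^ 2 / 4) <= (x - 1) * (1 - m - r0) ^ 2)
    by (apply Rmult_le_compat_l; lra).
  nra.
Qed.

(* The function h is the quotient of the Blaschke factors of f and of the
   identity; on circles |z| = rho it is bounded by a quantity tending to 1. *)
Lemma schwarz_pick_aux (f : C -> C) (z0 : C) :
  analytic_in_disc f -> (forall z, in_disc z -> Cmod (f z) <= 1) ->
  in_disc z0 -> Cmod (f z0) < 1 ->
  (forall z, in_disc z ->
     Cmod (f z - f z0)%C * Cmod (1 - Cconj z0 * z)%C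
     <= Cmod (z - z0)%C * Cmod (1 - Cconj (f z0) * f z)%C) /\
  exists c, derivative_at f z0 c /\ Cmod c * (1 - Cmod z0 ^ 2) <= 1 - Cmod (f z0) ^ 2.
Proof.
  unfold in_disc. intros Hf Hf1 Hz0 Hfz0.
  (* Order 4 for [f] leaves order 3 for the quotient [q], as [maximum_principle] requires. *)
  destruct (jet_derivative 2 f z0 (analytic_jet f z0 4 (Hf z0 Hz0))) as (q & Hq & Jq & Dq).
  set (D := fun z => (1 - Cconj (f z0) * f z)%C).
  set (N := fun z => (1 - Cconj z0 * z)%C).
  assert (HD : forall z, Cmod z < 1 -> D z <> 0%C)
    by (intros z Hz; apply one_sub_conj_mult_neq_0; auto).
  set (h := fun z => (q z * (N z * / D z))%C).
  assert (Jh : forall z, Cmod z < 1 -> jet 3 h z).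
  { intros z Hz.
    assert (Hlin : forall n (g : C -> C) (a : C), jet n g z -> jet n (fun z => 1 - a * g z)%C z).
    { intros n g a Jg. apply jet_plus; [apply jet_const|].
      apply (jet_ext _ (fun z => - a * g z)%C _ _ 1); [lra|intros; ring|].
      apply jet_mult; [apply jet_const|easy]. }
    unfold h. apply jet_mult; [|apply jet_mult].
    - destruct (classic (z = z0)) as [->|Hne]; [easy|].
      apply (jet_ext _ (fun z => (f z + - f z0) * / (z + - z0))%C _ _ (Cmod (z - z0)%C)).
      + now apply Cmod_sub_gt_0.
      + intros z' Hz'. rewrite Hq; [reflexivity|].
        intros ->. rewrite Cmod_sub_sym in Hz'. lra.
      + apply jet_mult.
        * apply jet_plus; [apply analytic_jet; now apply Hf|apply jet_const].
        * apply jet_inv; [apply jet_plus; [apply jet_id|apply jet_const]|].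
          apply Cmod_gt_0. now apply Cmod_sub_gt_0.
    - apply (Hlin _ (fun z => z)), jet_id.
    - apply jet_inv; [|now apply HD]. apply Hlin, analytic_jet. now apply Hf. }
  (* The Blaschke factor of [f] has modulus at most 1, so [|h z|] is at most [|N z| / |z - z0|],
     whose square exceeds 1 by at most a multiple of [1 - |z|^2]. *)
  assert (Hcirc : forall z, Cmod z < 1 -> Cmod z0 < Cmod z ->
            Cmod (h z) ^ 2 <= 1 + (1 - Cmod z ^ 2) / (Cmod z - Cmod z0) ^ 2).
  { intros z Hz Hzz.
    assert (Hne : z <> z0) by (intros ->; lra).
    pose proof (Cmod_sub_gt_0 _ _ Hne) as Hpos.
    assert (Hge : Cmod z - Cmod z0 <= Cmod (z - z0)%C)
      by (pose proof (Cmod_le_sub z z0); lra).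
    assert (HD0 : 0 < Cmod (D z)) by (apply Cmod_gt_0; auto).
    assert (E : Cmod (h z) * Cmod (z - z0)%C * Cmod (D z) = Cmod (f z - f z0)%C * Cmod (N z)).
    { rewrite <- !Cmod_mult. f_equal. unfold h. rewrite Hq by auto. field.
      split; [now apply HD|]. apply Cmod_gt_0; easy. }
    pose proof (Cmod2_one_sub_conj_mult (f z0) (f z)) as E1. fold (D z) in E1.
    pose proof (Cmod2_one_sub_conj_mult z0 z) as E2. fold (N z) in E2.
    pose proof (Hf1 z Hz) as Hfz.
    pose proof (Cmod_ge_0 (f z)). pose proof (Cmod_ge_0 (f z0)). pose proof (Cmod_ge_0 z0).
    pose proof (Cmod_ge_0 (f z - f z0)%C). pose proof (Cmod_ge_0 (N z)).
    pose proof (Cmod_ge_0 (h z)). pose proof (Cmod_ge_0 z).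
    assert (0 <= (1 - Cmod (f z0) ^ 2) * (1 - Cmod (f z) ^ 2))
      by (apply Rmult_le_pos; nra).
    assert (Hff : Cmod (f z - f z0)%C <= Cmod (D z)) by (apply Rsqr_incr_0; rewrite ?Rsqr_pow2; lra || apply Cmod_ge_0).
    assert (Hhn : Cmod (h z) * Cmod (z - z0)%C <= Cmod (N z)).
    { apply Rmult_le_reg_r with (Cmod (D z)); [easy|]. rewrite E, (Rmult_comm (Cmod (N z))).
      now apply Rmult_le_compat_r. }
    set (x := Cmod (h z)) in *. set (y := Cmod (z - z0)%C) in *.
    set (e := Cmod z - Cmod z0) in *.
    assert (He : 0 < e) by (unfold e; lra).
    assert (0 <= 1 - Cmod z ^ 2) by nra.
    assert (Hx : (x ^ 2 - 1) * y ^ 2 <= 1 - Cmod z ^ 2).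
    { assert ((x * y) ^ 2 <= Cmod (N z) ^ 2) by (apply pow_incr; split; [nra|easy]).
      assert ((1 - Cmod z0 ^ 2) * (1 - Cmod z ^ 2) <= 1 * (1 - Cmod z ^ 2))
        by (apply Rmult_le_compat_r; nra).
      replace ((x ^ 2 - 1) * y ^ 2) with ((x * y) ^ 2 - y ^ 2) by ring. lra. }
    assert (He2 : 0 < e ^ 2) by (apply pow_lt; easy).
    assert (0 <= (1 - Cmod z ^ 2) / e ^ 2) by (apply Rdiv_le_0_compat; easy).
    destruct (Rle_lt_dec (x ^ 2) 1); [lra|].
    assert ((x ^ 2 - 1) * e ^ 2 <= 1 - Cmod z ^ 2).
    { eapply Rle_trans; [|exact Hx]. apply Rmult_le_compat_l; [lra|]. apply pow_incr; lra. }
    assert (x ^ 2 - 1 <= (1 - Cmod z ^ 2) / e ^ 2); [|lra].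
    apply Rle_div_r; easy. }
  assert (Hh : forall z, Cmod z < 1 -> Cmod (h z) <= 1).
  { intros z Hz. pose proof (Cmod_ge_0 z). pose proof (Cmod_ge_0 z0).
    assert (Cmod (h z) ^ 2 <= 1); [|pose proof (Cmod_ge_0 (h z)); nra].
    apply (le_1_of_circle_bounds _ (Cmod z0) (Cmod z)); [lra|easy|].
    intros rho Hrho Hle.
    apply (maximum_principle h rho); [lra| | | |easy].
    - assert (0 <= (1 - rho ^ 2) / (rho - Cmod z0) ^ 2); [|lra].
      apply Rdiv_le_0_compat; [nra|apply pow_lt; lra].
    - intros w Hw. apply Jh; lra.
    - intros w Hw. rewrite <- Hw. apply Hcirc; lra. }
  split.
  - intros z Hz. fold (N z) (D z).
    destruct (classic (z = z0)) as [->|Hne].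
    { rewrite !Cmod_sub_diag; lra. }
    pose proof (Cmod_sub_gt_0 _ _ Hne) as Hpos.
    replace (Cmod (f z - f z0)%C * Cmod (N z))
      with (Cmod (h z) * (Cmod (z - z0)%C * Cmod (D z))).
    + rewrite <- (Rmult_1_l (Cmod (z - z0)%C * Cmod (D z))) at 2.
      apply Rmult_le_compat_r; [|auto].
      apply Rmult_le_pos; apply Cmod_ge_0.
    + rewrite <- !Cmod_mult. f_equal. unfold h. rewrite Hq by auto. field.
      split; [now apply HD|]. now apply Cmod_gt_0.
  (* Here [N z0 = 1 - |z0|^2] and [D z0 = 1 - |f z0|^2], so [|h z0| <= 1] is the derivative
     bound. *)
  - exists (q z0). split; [easy|].
    assert (Hself : forall a : C, Cmod a < 1 ->
              Cmod (1 - Cconj a * a)%C = 1 - Cmod a ^ 2).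
    { intros a Ha. pose proof (Cmod_ge_0 a).
      replace (1 - Cconj a * a)%C with (RtoC (1 - Cmod a ^ 2)).
      - rewrite Cmod_R, Rabs_pos_eq; nra.
      - rewrite RtoC_minus, Cmod2_conj. ring. }
    specialize (Hh z0 Hz0). unfold h in Hh.
    assert (HD0 : 0 < Cmod (D z0)) by (apply Cmod_gt_0; auto).
    rewrite !Cmod_mult, Cmod_inv in Hh by auto.
    replace (Cmod (N z0)) with (1 - Cmod z0 ^ 2) in Hh by (symmetry; now apply Hself).
    rewrite <- (Hself (f z0)) by easy. fold (D z0).
    apply (Rmult_le_compat_r (Cmod (D z0))) in Hh; [|lra].
    replace (Cmod (q z0) * ((1 - Cmod z0 ^ 2) * / Cmod (D z0)) * Cmod (D z0))
      with (Cmod (q z0) * (1 - Cmod z0 ^ 2)) in Hh by (field; lra).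
    lra.
Qed.

Lemma schwarz_lemma (w : C -> C) :
  analytic_in_disc w -> (forall z, in_disc z -> in_disc (w z)) -> w 0%C = 0%C ->
  forall z, in_disc z -> Cmod (w z) <= Cmod z.
Proof.
  unfold in_disc. intros Hw Hw1 Hw0 z Hz.
  destruct (schwarz_pick_aux w 0%C Hw) as [H _].
  - intros; apply Rlt_le; now apply Hw1.
  - unfold in_disc; rewrite Cmod_0; lra.
  - rewrite Hw0, Cmod_0; lra.
  - specialize (H z Hz). rewrite Hw0 in H.
    replace (Cconj 0) with (RtoC 0) in H by (unfold Cconj; cbn; now rewrite Ropp_0).
    replace (w z - 0)%C with (w z) in H by ring. replace (z - 0)%C with z in H by ring.
    replace (1 - 0 * z)%C with (RtoC 1) in H by ring.
    replace (1 - 0 * w z)%C with (RtoC 1) in H by ring.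
    rewrite Cmod_1 in H. lra.
Qed.

Lemma analytic_at_scal (f : C -> C) (z0 a : C) :
  analytic_at f z0 -> analytic_at (fun z => a * f z)%C z0.
Proof.
  intros (c & rho & Hrho & H).
  exists (PS_scal a c), rho. split; [easy|]. intros z Hz.
  apply (is_pseries_scal (K := C_AbsRing) (V := C_NormedModule) a c (z - z0)%C (f z));
    [|now apply H].
  apply Cmult_comm.
Qed.

Lemma schwarz_pick (f : C -> C) (z0 : C) :
  analytic_in_disc f -> (forall z, in_disc z -> Cmod (f z) <= 1) -> in_disc z0 ->
  exists c, derivative_at f z0 c /\ Cmod c * (1 - Cmod z0 ^ 2) <= 1 - Cmod (f z0) ^ 2.
Proof.
  intros Hf Hf1 Hz0. unfold in_disc in *.
  destruct (jet_derivative 0 f z0 (analytic_jet f z0 2 (Hf z0 Hz0))) as (h & _ & _ & Dh).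
  exists (h z0). split; [easy|].
  set (a := Cmod (h z0) * (1 - Cmod z0 ^ 2)). set (b := Cmod (f z0)).
  assert (Hb : 0 <= b <= 1) by (split; [apply Cmod_ge_0|now apply Hf1]).
  pose proof (Cmod_ge_0 (h z0)). pose proof (Cmod_ge_0 z0).
  assert (0 <= a) by (apply Rmult_le_pos; nra).
  (* Shrinking f by t < 1 avoids the degenerate case |f z0| = 1. *)
  assert (Ht : forall t, 0 < t < 1 -> t * a <= 1 - t ^ 2 * b ^ 2).
  { intros t Ht.
    assert (Mt : Cmod (RtoC t) = t) by (rewrite Cmod_R, Rabs_pos_eq; lra).
    destruct (schwarz_pick_aux (fun z => RtoC t * f z)%C z0) as [_ (c & Dc & Hc)].
    - intros z Hz. apply analytic_at_scal. now apply Hf.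
    - intros z Hz. rewrite Cmod_mult, Mt. pose proof (Hf1 z Hz).
      pose proof (Cmod_ge_0 (f z)). nra.
    - exact Hz0.
    - rewrite Cmod_mult, Mt. fold b. nra.
    - assert (E : c = (RtoC t * h z0)%C).
      { apply (derivative_at_unique (fun z => RtoC t * f z)%C (fun z => RtoC t * f z)%C z0 _ _ 1);
          [lra|easy|easy|now apply derivative_at_scal]. }
      rewrite E, !Cmod_mult, Mt in Hc. fold b in Hc.
      unfold a. rewrite Rpow_mult_distr in Hc. lra. }
  destruct (Rle_lt_dec a (1 - b ^ 2)) as [|Hlt]; [easy|exfalso].
  (* Passing from 1 to [t = 1 - eta] changes the inequality by at most [eta (a + 2)], which is half
     the excess. *)
  set (eta := (a - (1 - b ^ 2)) / (2 * (a + 2))).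
  assert (He : eta * (2 * (a + 2)) = a - (1 - b ^ 2)) by (unfold eta; field; lra).
  assert (Hb2 : 0 <= b ^ 2 <= 1) by nra.
  assert (0 < eta) by (apply Rdiv_lt_0_compat; lra).
  assert (eta < 1) by nra.
  specialize (Ht (1 - eta) ltac:(lra)). nra.
Qed.

(** * Termwise differentiation of power series *)

(** [CSeries] has a value even for divergent series, so its algebra requires convergence; the
    absolute form passes by comparison to real and imaginary parts. *)
Definition summable (u : nat -> C) : Prop := ex_series (fun j => Cmod (u j)).

Lemma ex_series_mult_l (c : R) (a : nat -> R) :
  ex_series a -> ex_series (fun j => c * a j).
Proof.
  exact (ex_series_scal (K := R_AbsRing) (V := R_NormedModule) c a).
Qed.

Lemma summable_le (u : nat -> C) (v : nat -> R) :
  (forall j, Cmod (u j) <= v j) -> ex_series v -> summable u.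
Proof.
  intros H Hv. apply (ex_series_le (K := R_AbsRing) (V := R_CompleteNormedModule) _ v); [|easy].
  intros j. change (Rabs (Cmod (u j)) <= v j). rewrite Rabs_pos_eq; auto using Cmod_ge_0.
Qed.

Lemma summable_Re (u : nat -> C) : summable u -> ex_series (fun j => Rabs (Re (u j))).
Proof.
  intros H. apply (ex_series_le (K := R_AbsRing) (V := R_CompleteNormedModule) _ (fun j => Cmod (u j))); [|easy].
  intros j. change (Rabs (Rabs (Re (u j))) <= Cmod (u j)).
  rewrite Rabs_Rabsolu. apply re_le_Cmod.
Qed.

Lemma summable_Im (u : nat -> C) : summable u -> ex_series (fun j => Rabs (Im (u j))).
Proof.
  intros H. apply (ex_series_le (K := R_AbsRing) (V := R_CompleteNormedModule) _ (fun j => Cmod (u j))); [|easy].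
  intros j. change (Rabs (Rabs (Im (u j))) <= Cmod (u j)).
  rewrite Rabs_Rabsolu. eapply Rle_trans; [apply Rmax_r|apply Rmax_Cmod].
Qed.

Lemma CSeries_ext (u v : nat -> C) : (forall j, u j = v j) -> CSeries u = CSeries v.
Proof.
  intros H. unfold CSeries. f_equal; apply Series_ext; intros j; now rewrite H.
Qed.

Lemma CSeries_plus (u v : nat -> C) : summable u -> summable v ->
  CSeries (fun j => u j + v j)%C = (CSeries u + CSeries v)%C.
Proof.
  intros Hu Hv. unfold CSeries, Cplus. cbn [fst snd].
  f_equal; rewrite <- Series_plus; auto using ex_series_Rabs, summable_Re, summable_Im.
Qed.

Lemma CSeries_scal (c : C) (u : nat -> C) : summable u ->
  CSeries (fun j => c * u j)%C = (c * CSeries u)%C.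
Proof.
  intros Hu. pose proof (ex_series_Rabs _ (summable_Re u Hu)) as HR.
  pose proof (ex_series_Rabs _ (summable_Im u Hu)) as HI.
  unfold CSeries. apply injective_projections; cbn [fst snd Cmult].
  - rewrite <- !Series_scal_l, <- Series_minus.
    + apply Series_ext; intros j. cbn. reflexivity.
    + now apply ex_series_mult_l.
    + now apply ex_series_mult_l.
  - rewrite <- !Series_scal_l, <- Series_plus.
    + apply Series_ext; intros j. cbn. reflexivity.
    + now apply ex_series_mult_l.
    + now apply ex_series_mult_l.
Qed.

Lemma summable_scal (c : C) (u : nat -> C) : summable u -> summable (fun j => c * u j)%C.
Proof.
  intros Hu. apply (summable_le _ (fun j => Cmod c * Cmod (u j))).
  - intros j. rewrite Cmod_mult; lra.
  - now apply ex_series_mult_l.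
Qed.

Lemma summable_plus (u v : nat -> C) : summable u -> summable v ->
  summable (fun j => u j + v j)%C.
Proof.
  intros Hu Hv. apply (summable_le _ (fun j => Cmod (u j) + Cmod (v j))).
  - intros j. apply Cmod_triangle.
  - exact (ex_series_plus (K := R_AbsRing) (V := R_NormedModule) _ _ Hu Hv).
Qed.

Lemma Cmod_CSeries_le (u : nat -> C) (v : nat -> R) :
  (forall j, Cmod (u j) <= v j) -> ex_series v -> Cmod (CSeries u) <= 2 * Series v.
Proof.
  intros H Hv. pose proof (summable_le u v H Hv) as Hu.
  eapply Rle_trans; [apply Cmod_le_abs_Re_Im|]. cbn [CSeries Re Im fst snd].
  assert (Rabs (Series (fun j => Re (u j))) <= Series v).
  { eapply Rle_trans; [apply Series_Rabs; now apply summable_Re|].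
    apply Series_le; [|easy]. intros j; split; [apply Rabs_pos|].
    eapply Rle_trans; [apply re_le_Cmod|apply H]. }
  assert (Rabs (Series (fun j => Im (u j))) <= Series v).
  { eapply Rle_trans; [apply Series_Rabs; now apply summable_Im|].
    apply Series_le; [|easy]. intros j; split; [apply Rabs_pos|].
    eapply Rle_trans; [|apply H]. eapply Rle_trans; [apply Rmax_r|apply Rmax_Cmod]. }
  lra.
Qed.

(* Equivalent to: the power series with coefficients b has radius of
   convergence at least 1. *)
Definition subexponential (b : nat -> C) : Prop :=
  forall s, 0 < s < 1 -> exists M, forall j, Cmod (b j) * s ^ j <= M.

Lemma subexponential_of_series (q : nat) (a : nat -> C) :
  (forall z, in_disc z -> exists l, is_series (fun j => a j * z ^ (q + j))%C l) ->
  subexponential a.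
Proof.
  intros H s Hs.
  assert (Ms : Cmod (RtoC s) = s) by (rewrite Cmod_R, Rabs_pos_eq; lra).
  destruct (H (RtoC s) ltac:(unfold in_disc; lra)) as [l Hl].
  destruct (is_series_terms_bounded _ _ Hl) as (M & _ & HM).
  assert (Hq : 0 < s ^ q) by (apply pow_lt; lra).
  exists (M / s ^ q). intros j. specialize (HM j).
  rewrite Cmod_mult, Cmod_pow, Ms, pow_add in HM.
  apply -> Rle_div_r; lra.
Qed.

(** Linear growth is absorbed by raising the radius from [s] to [t]: with [t / s = 1 + x], Bernoulli
    gives [(1 + x)^j >= 1 + j x]. *)
Lemma subexponential_mult (rho : nat -> R) (K : R) (b : nat -> C) :
  (forall j, Rabs (rho j) <= K * (INR j + 1)) -> subexponential b ->
  subexponential (fun j => RtoC (rho j) * b j)%C.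
Proof.
  intros Hrho Hb s Hs.
  set (t := (1 + s) / 2). assert (Ht : s < t < 1) by (unfold t; lra).
  destruct (Hb t ltac:(lra)) as [M HM].
  set (x := t / s - 1).
  assert (Hx : 0 < x).
  { unfold x. assert (1 < t / s); [|lra]. apply -> Rlt_div_r; lra. }
  assert (HK : 0 <= K).
  { specialize (Hrho O). pose proof (Rabs_pos (rho O)). simpl in Hrho. lra. }
  exists (K * (1 + / x) * M). intros j.
  assert (Hj : (INR j + 1) * s ^ j <= (1 + / x) * t ^ j).
  { assert (Hpow : t ^ j = s ^ j * (1 + x) ^ j).
    { rewrite <- Rpow_mult_distr. f_equal. unfold x. field; lra. }
    assert (Hber : 1 + INR j * x <= (1 + x) ^ j) by (apply poly; easy).
    assert (0 <= INR j) by apply pos_INR.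
    assert (0 < s ^ j) by (apply pow_lt; lra).
    rewrite Hpow.
    assert (INR j + 1 <= (1 + / x) * (1 + x) ^ j).
    { assert (0 < / x) by (apply Rinv_0_lt_compat; easy).
      apply Rle_trans with ((1 + / x) * (1 + INR j * x)).
      - replace ((1 + / x) * (1 + INR j * x)) with (1 + INR j + (/ x + INR j * x))
          by (field; lra). nra.
      - apply Rmult_le_compat_l; lra. }
    nra. }
  rewrite Cmod_mult, Cmod_R.
  pose proof (Cmod_ge_0 (b j)). specialize (HM j). specialize (Hrho j).
  assert (0 < s ^ j) by (apply pow_lt; lra).
  apply Rle_trans with (K * (INR j + 1) * Cmod (b j) * s ^ j).
  - apply Rmult_le_compat_r; [lra|]. now apply Rmult_le_compat_r.
  - apply Rle_trans with (K * Cmod (b j) * ((1 + / x) * t ^ j)).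
    + replace (K * (INR j + 1) * Cmod (b j) * s ^ j)
        with (K * Cmod (b j) * ((INR j + 1) * s ^ j)) by ring.
      apply Rmult_le_compat_l; [now apply Rmult_le_pos|easy].
    + replace (K * Cmod (b j) * ((1 + / x) * t ^ j))
        with (K * (1 + / x) * (Cmod (b j) * t ^ j)) by ring.
      apply Rmult_le_compat_l; [|easy].
      apply Rmult_le_pos; [easy|].
      assert (0 < / x) by (apply Rinv_0_lt_compat; easy). lra.
Qed.

(** Nonnegative powers iterate the linear growth bound; negative ones are at most 1 because
    [lam j >= 1]. *)
Lemma subexponential_powerRZ (lam : nat -> R) (K : R) (m : Z) (b : nat -> C) :
  (forall j, 1 <= lam j <= K * (INR j + 1)) -> subexponential b ->
  subexponential (fun j => RtoC (powerRZ (lam j) m) * b j)%C.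
Proof.
  intros Hlam Hb.
  assert (Hext : forall c d : nat -> C, (forall j, c j = d j) ->
            subexponential c -> subexponential d).
  { intros c d E Hc s Hs. destruct (Hc s Hs) as [M HM]. exists M. intros j.
    rewrite <- E. apply HM. }
  assert (Hpow : forall n, subexponential (fun j => RtoC (lam j ^ n) * b j)%C).
  { induction n as [|n IH].
    - apply (Hext b); [|easy]. intros j. simpl. ring.
    - apply (Hext (fun j => RtoC (lam j) * (RtoC (lam j ^ n) * b j))%C).
      + intros j. cbn [pow]. rewrite RtoC_mult. ring.
      + apply subexponential_mult with K; [|easy]. intros j. specialize (Hlam j).
        rewrite Rabs_pos_eq; lra. }
  destruct m as [|n|n]; cbn [powerRZ].
  - apply (Hpow O).
  - apply Hpow.
  - intros s Hs. destruct (Hb s Hs) as [M HM]. exists M. intros j.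
    eapply Rle_trans; [|apply HM]. apply Rmult_le_compat_r; [apply pow_le; lra|].
    rewrite Cmod_mult, Cmod_R.
    assert (1 <= lam j ^ Pos.to_nat n) by (apply pow_R1_Rle; apply Hlam).
    assert (0 < / lam j ^ Pos.to_nat n) by (apply Rinv_0_lt_compat; lra).
    rewrite Rabs_pos_eq by lra.
    assert (/ lam j ^ Pos.to_nat n <= 1).
    { rewrite <- Rinv_1. apply Rinv_le_contravar; lra. }
    pose proof (Cmod_ge_0 (b j)). nra.
Qed.

Lemma subexponential_summable (q : nat) (b : nat -> C) (z : C) :
  subexponential b -> in_disc z -> summable (fun j => b j * z ^ (q + j))%C.
Proof.
  unfold in_disc. intros Hb Hz. pose proof (Cmod_ge_0 z) as Hz0.
  set (s := (1 + Cmod z) / 2). assert (Hs : Cmod z < s < 1) by (unfold s; lra).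
  destruct (Hb s ltac:(lra)) as [M HM].
  apply (summable_le _ (fun j => M * (Cmod z / s) ^ j)).
  - intros j. rewrite Cmod_mult, Cmod_pow, pow_add.
    assert (0 <= Cmod z ^ j) by now apply pow_le.
    assert (0 <= Cmod z ^ q <= 1).
    { split; [now apply pow_le|]. rewrite <- (pow1 q). apply pow_incr; lra. }
    assert (0 < s ^ j) by (apply pow_lt; lra).
    pose proof (Cmod_ge_0 (b j)). specialize (HM j).
    apply Rle_trans with (Cmod (b j) * Cmod z ^ j).
    + apply Rmult_le_compat_l; [easy|]. nra.
    + replace (Cmod (b j) * Cmod z ^ j) with (Cmod (b j) * s ^ j * (Cmod z / s) ^ j).
      * apply Rmult_le_compat_r; [|easy]. apply pow_le.
        apply Rdiv_le_0_compat; lra.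
      * rewrite Rmult_assoc, <- Rpow_mult_distr. f_equal. f_equal. field; lra.
  - apply ex_series_mult_l. apply ex_series_geom.
    rewrite Rabs_pos_eq by (apply Rdiv_le_0_compat; lra). apply <- Rlt_div_l; lra.
Qed.

(** The quadratic errors of the monomials carry the factor [(n j)^2], so summing them needs the
    coefficients multiplied by [n] twice to remain subexponential. *)
Lemma derivative_at_series (q : nat) (b : nat -> C) (z0 : C) :
  subexponential b -> in_disc z0 ->
  derivative_at (fun z => CSeries (fun j => b j * z ^ (S q + j)))%C z0
    (CSeries (fun j => (RtoC (INR (S q + j)) * b j) * z0 ^ (q + j))%C).
Proof.
  intros Hb Hz0.
  set (n := fun j => INR (S q + j)).
  assert (Hn : forall j, 0 <= n j /\ Rabs (n j) <= INR (S q) * (INR j + 1)).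
  { intros j. unfold n. split; [apply pos_INR|].
    rewrite Rabs_pos_eq by apply pos_INR. rewrite plus_INR.
    pose proof (pos_INR j). assert (1 <= INR (S q)) by (rewrite S_INR; pose proof (pos_INR q); lra).
    nra. }
  assert (Hnb : subexponential (fun j => RtoC (n j) * b j)%C).
  { apply subexponential_mult with (INR (S q)); [|easy]. apply Hn. }
  assert (Hnnb : subexponential (fun j => RtoC (n j) * (RtoC (n j) * b j))%C).
  { apply subexponential_mult with (INR (S q)); [|easy]. apply Hn. }
  unfold in_disc in Hz0. pose proof (Cmod_ge_0 z0) as Hz0'.
  (* All points within [s - |z0|] of [z0] have modulus below [s], so the single majorant [v] serves
     for all of them. *)
  set (s := (1 + Cmod z0) / 2). assert (Hs : Cmod z0 < s < 1) by (unfold s; lra).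
  assert (Ms : Cmod (RtoC s) = s) by (rewrite Cmod_R, Rabs_pos_eq; lra).
  set (v := fun j => Cmod ((RtoC (n j) * (RtoC (n j) * b j)) * RtoC s ^ (q + j))%C).
  assert (Hv : ex_series v).
  { apply (subexponential_summable q _ (RtoC s) Hnnb). unfold in_disc; lra. }
  assert (Hvpos : 0 <= Series v).
  { apply Rle_trans with (Series (fun j => 0 * v j)); [rewrite Series_scal_l; lra|].
    apply Series_le; [|easy]. intros j. pose proof (Cmod_ge_0 (RtoC (n j) * (RtoC (n j) * b j) * RtoC s ^ (q + j))%C) as Hj.
    fold (v j) in Hj. lra. }
  exists (2 * Series v / s), (s - Cmod z0). split; [lra|].
  split; [apply Rdiv_le_0_compat; lra|].
  intros z Hz. pose proof (Cmod_le_sub z z0) as Hzs.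
  assert (D1 : in_disc z) by (unfold in_disc; lra).
  set (t := Cmod (z - z0)%C) in *.
  assert (S1 := subexponential_summable (S q) b z Hb D1).
  assert (S2 := subexponential_summable (S q) b z0 Hb Hz0).
  assert (S3 := subexponential_summable q _ z0 Hnb Hz0).
  set (E := fun j => (z ^ (S q + j) - z0 ^ (S q + j) - RtoC (n j) * z0 ^ (q + j) * (z - z0))%C).
  assert (Eq : (CSeries (fun j => b j * z ^ (S q + j)) - CSeries (fun j => b j * z0 ^ (S q + j))
             - CSeries (fun j => (RtoC (n j) * b j) * z0 ^ (q + j)) * (z - z0)
             = CSeries (fun j => b j * E j))%C).
  { transitivity
      (CSeries (fun j => b j * z ^ (S q + j))
       + (-(1) * CSeries (fun j => b j * z0 ^ (S q + j))
          + - (z - z0) * CSeries (fun j => (RtoC (n j) * b j) * z0 ^ (q + j))))%C; [ring|].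
    rewrite <- (CSeries_scal (- (1))) by easy.
    rewrite <- (CSeries_scal (- (z - z0))) by easy.
    rewrite <- CSeries_plus by now apply summable_scal.
    rewrite <- CSeries_plus; [|easy|].
    - apply CSeries_ext. intros j. unfold E. ring.
    - apply summable_plus; now apply summable_scal. }
  fold n. unfold n in Eq. rewrite Eq.
  replace (2 * Series v / s * t ^ 2) with (2 * Series (fun j => t ^ 2 / s * v j)).
  2: { rewrite Series_scal_l. field; lra. }
  apply Cmod_CSeries_le.
  - intros j. unfold v. rewrite !Cmod_mult, Cmod_pow, Ms, Cmod_R, (Rabs_pos_eq (n j)) by apply Hn.
    pose proof (pow_linear_approx (q + j) s z z0 ltac:(lra) ltac:(lra)) as HE.
    change (S (q + j)) with (S q + j)%nat in HE. fold (n j) in HE. fold (E j) in HE. fold t in HE.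
    pose proof (Cmod_ge_0 (b j)).
    apply Rmult_le_reg_l with s; [lra|].
    apply (Rmult_le_compat_l (Cmod (b j))) in HE; [|easy].
    replace (s * (t ^ 2 / s * (n j * (n j * Cmod (b j)) * s ^ (q + j))))
      with (Cmod (b j) * (n j ^ 2 * s ^ (q + j) * t ^ 2)) by (field; lra).
    lra.
  - now apply ex_series_mult_l.
Qed.

(** * The operator Theta and the radius *)

Lemma Theta_derivative (p : nat) (m : Z) (alpha beta : R) (f : Ap p) (z : C) :
  (1 <= p)%nat -> 0 < beta -> 0 < alpha + INR p * beta -> in_disc z ->
  exists D, derivative_at (Theta p m alpha beta f) z D /\
    (RtoC (alpha + INR p * beta) * Theta p (m + 1) alpha beta f z
     = RtoC alpha * Theta p m alpha beta f z + RtoC beta * z * D)%C.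
Proof.
  intros Hp Hbeta Hc Hz.
  set (c := alpha + INR p * beta) in *.
  set (lam := fun j => (alpha + INR (p + 1 + j) * beta) / c).
  assert (Elam : forall j, lam j = 1 + (INR j + 1) * (beta / c)).
  { intros j. unfold lam. rewrite !plus_INR. simpl (INR 1).
    replace (alpha + (INR p + 1 + INR j) * beta) with (c + (INR j + 1) * beta)
      by (unfold c; ring). field; lra. }
  assert (Hbc : 0 < beta / c) by (apply Rdiv_lt_0_compat; easy).
  assert (Hlam : forall j, 1 <= lam j <= (1 + beta / c) * (INR j + 1)).
  { intros j. rewrite Elam. pose proof (pos_INR j). split; nra. }
  assert (Ha : subexponential (fun j => Ap_coef f (p + 1 + j))).
  { apply (subexponential_of_series (p + 1)). intros z' Hz'.
    exists (f z' - z' ^ p)%C. now apply Ap_expansion. }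
  set (b := fun (n : Z) (j : nat) => (RtoC (powerRZ (lam j) n) * Ap_coef f (p + 1 + j))%C).
  assert (Hb : forall n, subexponential (b n))
    by (intros n; apply (subexponential_powerRZ lam (1 + beta / c)); auto).
  assert (ETheta : forall n z', Theta p n alpha beta f z'
            = (z' ^ p + CSeries (fun j => b n j * z' ^ (S p + j)))%C).
  { intros n z'. unfold Theta. f_equal. apply CSeries_ext. intros j.
    unfold b, lam, c. cbv zeta. replace (S p + j)%nat with (p + 1 + j)%nat by lia.
    reflexivity. }
  (* Writing [p = S q] gives the derivative the exponent [q] without truncated subtraction. *)
  destruct p as [|q]; [lia|].
  exists (RtoC (INR (S q)) * z ^ q
          + CSeries (fun j => (RtoC (INR (S (S q) + j)) * b m j) * z ^ (S q + j)))%C.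
  split.
  - apply (derivative_at_ext (fun z' => z' ^ S q + CSeries (fun j => b m j * z' ^ (S (S q) + j)))%C).
    { intros z'. now rewrite ETheta. }
    apply derivative_at_plus; [apply derivative_at_pow|].
    now apply derivative_at_series.
  - rewrite !ETheta.
    assert (S0 : forall n, summable (fun j => b n j * z ^ (S (S q) + j))%C)
      by (intros n; now apply subexponential_summable).
    assert (S1 : summable (fun j => (RtoC (INR (S (S q) + j)) * b m j) * z ^ (S q + j))%C).
    { apply subexponential_summable; [|easy].
      apply subexponential_mult with (INR (S (S q))); [|easy].
      intros j. rewrite Rabs_pos_eq by apply pos_INR. rewrite plus_INR.
      pose proof (pos_INR j). assert (1 <= INR (S (S q))).
      { rewrite S_INR. pose proof (pos_INR (S q)). lra. }
      nra. }
    assert (E : (RtoC c * CSeries (fun j => b (m + 1)%Z j * z ^ (S (S q) + j))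
              = RtoC alpha * CSeries (fun j => b m j * z ^ (S (S q) + j))
                + RtoC beta * z
                  * CSeries (fun j => (RtoC (INR (S (S q) + j)) * b m j) * z ^ (S q + j)))%C).
    { rewrite <- !CSeries_scal by easy.
      rewrite <- CSeries_plus by now apply summable_scal.
      apply CSeries_ext. intros j. unfold b.
      pose proof (Hlam j). rewrite powerRZ_add by lra. rewrite powerRZ_1, RtoC_mult.
      (* This is [c lam = alpha + k beta] at the index [k] of the term: one more power of the
         multiplier amounts, up to [c], to applying [alpha + beta z d/dz]. *)
      assert (El : (RtoC c * RtoC (lam j)
                = RtoC alpha + RtoC (INR (S (S q) + j)) * RtoC beta)%C).
      { rewrite <- !RtoC_mult, <- RtoC_plus. f_equal. unfold lam.
        replace (S q + 1 + j)%nat with (S (S q) + j)%nat by lia. field; lra. }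
      change (S (S q) + j)%nat with (S (S q + j)) at 1 2. rewrite Cpow_S.
      transitivity ((RtoC c * RtoC (lam j))
        * (RtoC (powerRZ (lam j) m) * Ap_coef f (S q + 1 + j) * (z * z ^ (S q + j))))%C;
        [ring|]. rewrite El. ring. }
    rewrite Cmult_plus_distr_l, E. unfold c. rewrite RtoC_plus, RtoC_mult, Cpow_S. ring.
Qed.

Lemma radius_poly_factor (p : nat) (alpha beta A B r : R) :
  radius_poly p alpha beta A B r
  = (alpha + INR p * beta) * ((1 - r ^ 2) * (1 - Rabs A * r))
    - 2 * beta * (r * (1 + Rabs B * r)).
Proof. unfold radius_poly. ring. Qed.

(* By the factored form, the polynomial is a decreasing function minus an
   increasing one on [0, 1]. *)
Lemma radius_poly_decreasing (p : nat) (alpha beta A B s r : R) :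
  0 < beta -> 0 < alpha + INR p * beta -> Rabs A <= 1 -> 0 <= s -> s < r -> r <= 1 ->
  radius_poly p alpha beta A B r < radius_poly p alpha beta A B s.
Proof.
  intros Hbeta Hc HA Hs Hsr Hr. rewrite !radius_poly_factor.
  pose proof (Rabs_pos A) as HA0. pose proof (Rabs_pos B) as HB0.
  assert (H1 : (1 - r ^ 2) * (1 - Rabs A * r) <= (1 - s ^ 2) * (1 - Rabs A * s))
    by (apply Rmult_le_compat; nra).
  assert (H2 : s * (1 + Rabs B * s) < r * (1 + Rabs B * r)).
  { assert (Rabs B * s * s <= Rabs B * r * r) by (apply Rmult_le_compat; nra). nra. }
  apply (Rmult_le_compat_l (alpha + INR p * beta)) in H1; [|lra].
  apply (Rmult_lt_compat_l (2 * beta)) in H2; lra.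
Qed.

(** The polynomial is [alpha + p beta] at 0 and [-2 beta (1 + |B|)] at 1, hence changes sign; strict
    decrease on [[0, 1]] excludes a smaller positive root. *)
Lemma radius_poly_smallest_root (p : nat) (alpha beta A B : R) :
  0 < beta -> 0 < alpha + INR p * beta -> Rabs A <= 1 ->
  exists r, r < 1 /\ smallest_positive_root (radius_poly p alpha beta A B) r.
Proof.
  intros Hbeta Hc HA.
  set (P := radius_poly p alpha beta A B).
  pose proof (Rabs_pos B) as HB0.
  destruct (IVT (fun x => - P x) 0 1) as (r & Hr & Er).
  - unfold P, radius_poly. reg.
  - lra.
  - unfold P, radius_poly. simpl. lra.
  - unfold P, radius_poly. simpl. nra.
  - assert (Hr0 : r <> 0).
    { intros ->. revert Er. unfold P, radius_poly. simpl. lra. }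
    assert (Hr1 : r <> 1).
    { intros ->. revert Er. unfold P, radius_poly. simpl. nra. }
    exists r. split; [lra|]. split; [lra|]. split; [fold P; lra|].
    intros s Hs Es. destruct (Rle_lt_dec r s) as [|Hlt]; [easy|exfalso].
    pose proof (radius_poly_decreasing p alpha beta A B s r Hbeta Hc HA
                  ltac:(lra) Hlt ltac:(lra)) as Hd.
    fold P in Hd, Es. lra.
Qed.

(** * The estimate for majorized functions *)

Lemma Cmod_one_plus_le (a : R) (w : C) (rho : R) :
  Cmod w <= rho ->
  1 - Rabs a * rho <= Cmod (1 + RtoC a * w)%C <= 1 + Rabs a * rho.
Proof.
  intros Hw.
  assert (Haw : Cmod (RtoC a * w)%C <= Rabs a * rho).
  { rewrite Cmod_mult, Cmod_R. apply Rmult_le_compat_l; [apply Rabs_pos|easy]. }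
  pose proof (Cmod_triangle 1 (RtoC a * w)) as T. rewrite Cmod_1 in T.
  pose proof (Cmod_le_sub 1 (1 + RtoC a * w)) as T'. rewrite Cmod_1 in T'.
  replace (1 - (1 + RtoC a * w))%C with (- (RtoC a * w))%C in T' by ring.
  rewrite Cmod_opp in T'. lra.
Qed.

Theorem theorem5p1 :
  forall (p : nat) (m : Z) (alpha beta A B : R),
    (1 <= p)%nat -> 0 < beta -> 0 < alpha + INR p * beta ->
    -1 <= B -> B < A -> A <= 1 ->
    exists r : R,
      smallest_positive_root (radius_poly p alpha beta A B) r /\
      forall f g : Ap p,
        quotient_subordinate
          (Theta p (m + 2) alpha beta g) (Theta p (m + 1) alpha beta g)
          (fun z => ((1 + RtoC A * z) / (1 + RtoC B * z))%C) ->
        majorized (Theta p (m + 1) alpha beta f) (Theta p (m + 1) alpha beta g) ->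
        forall z : C, Cmod z < r ->
          Cmod (Theta p (m + 2) alpha beta f z)
          <= Cmod (Theta p (m + 2) alpha beta g z).
Proof.
  intros p m alpha beta A B Hp Hbeta Hc HB HBA HA.
  assert (HA1 : Rabs A <= 1) by (apply Rabs_le; lra).
  assert (HB1 : Rabs B <= 1) by (apply Rabs_le; lra).
  destruct (radius_poly_smallest_root p alpha beta A B Hbeta Hc HA1) as (r & Hr1 & Hr).
  exists r. split; [exact Hr|].
  intros f g (q & [_ Hquot] & w & Hw & Hw1 & Hw0 & Hqw) (phi & Hphi & Hphi1 & HFG) z Hz.
  assert (Dz : in_disc z) by (unfold in_disc; lra).
  replace (m + 2)%Z with (m + 1 + 1)%Z in * by lia.
  destruct (Theta_derivative p (m + 1) alpha beta f z Hp Hbeta Hc Dz) as (Df & HDf & Ef).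
  destruct (Theta_derivative p (m + 1) alpha beta g z Hp Hbeta Hc Dz) as (Dg & HDg & Eg).
  set (F := Theta p (m + 1) alpha beta f) in *.
  set (G := Theta p (m + 1) alpha beta g) in *.
  set (F1 := Theta p (m + 1 + 1) alpha beta f) in *.
  set (G1 := Theta p (m + 1 + 1) alpha beta g) in *.
  destruct (schwarz_pick phi z Hphi Hphi1 Dz) as (Dphi & HDphi & Hpick).
  set (c := alpha + INR p * beta) in *.
  set (rho := Cmod z) in *.
  assert (Hrho0 : 0 <= rho) by apply Cmod_ge_0.
  (* Majorization holds only in the disc, so [F] and [phi G] are compared within [1 - rho] of
     [z]. *)
  assert (EDf : Df = (Dphi * G z + phi z * Dg)%C).
  { apply (derivative_at_unique F (fun z => phi z * G z)%C z _ _ (1 - rho)); [lra| |easy|].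
    - intros z' Hz'. apply HFG. unfold in_disc. pose proof (Cmod_le_sub z' z).
      fold rho in H. lra.
    - now apply derivative_at_mult. }
  assert (EF1 : (RtoC c * F1 z = phi z * (RtoC c * G1 z) + RtoC beta * z * Dphi * G z)%C).
  { rewrite Ef, Eg, EDf. rewrite (HFG z Dz). ring. }
  assert (Mc : forall u, Cmod (RtoC c * u)%C = c * Cmod u)
    by (intros u; rewrite Cmod_mult, Cmod_R, Rabs_pos_eq; lra).
  assert (HF1 : c * Cmod (F1 z)
            <= Cmod (phi z) * (c * Cmod (G1 z)) + beta * rho * Cmod Dphi * Cmod (G z)).
  { rewrite <- !Mc, EF1. eapply Rle_trans; [apply Cmod_triangle|].
    rewrite !Cmod_mult, (Cmod_R beta), (Rabs_pos_eq beta) by lra. fold rho. lra. }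
  (* At 0 the quotient hypothesis says nothing about [G], but there the term with [Dphi]
     vanishes. *)
  destruct (classic (z = 0%C)) as [E0|Hnz].
  { assert (Hrho : rho = 0) by (unfold rho; rewrite E0; apply Cmod_0).
    rewrite Hrho in HF1. pose proof (Hphi1 z Dz). pose proof (Cmod_ge_0 (G1 z)).
    apply Rmult_le_reg_l with c; [easy|].
    assert (Cmod (phi z) * (c * Cmod (G1 z)) <= 1 * (c * Cmod (G1 z)))
      by (apply Rmult_le_compat_r; [apply Rmult_le_pos|]; lra).
    lra. }
  assert (Hrho : 0 < rho) by now apply Cmod_gt_0.
  destruct (Hquot z Dz Hnz) as [HGnz Eq].
  pose proof (schwarz_lemma w Hw Hw1 Hw0 z Dz) as Hwz. fold rho in Hwz.
  pose proof (Cmod_one_plus_le A (w z) rho Hwz) as HAw.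
  pose proof (Cmod_one_plus_le B (w z) rho Hwz) as HBw.
  assert (HArho : 0 < 1 - Rabs A * rho) by (pose proof (Rabs_pos A); nra).
  assert (HBrho : 0 < 1 - Rabs B * rho) by (pose proof (Rabs_pos B); nra).
  assert (HBnz : (1 + RtoC B * w z)%C <> 0%C) by (apply Cmod_gt_0; lra).
  assert (EGG : (G z * (1 + RtoC A * w z) = G1 z * (1 + RtoC B * w z))%C).
  { rewrite (Hqw z Dz) in Eq. apply (f_equal (fun u => u * (G z * (1 + RtoC B * w z)))%C) in Eq.
    transitivity ((1 + RtoC A * w z) / (1 + RtoC B * w z) * (G z * (1 + RtoC B * w z)))%C;
      [field; easy|]. rewrite Eq. field; easy. }
  apply (f_equal Cmod) in EGG. rewrite !Cmod_mult in EGG.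
  pose proof (Cmod_ge_0 (G z)) as G0. pose proof (Cmod_ge_0 (G1 z)) as G10.
  pose proof (Cmod_ge_0 (phi z)) as P0. pose proof (Hphi1 z Dz) as P1.
  pose proof (Cmod_ge_0 Dphi) as D0.
  assert (HGG : Cmod (G z) * (1 - Rabs A * rho) <= Cmod (G1 z) * (1 + Rabs B * rho)).
  { apply Rle_trans with (Cmod (G z) * Cmod (1 + RtoC A * w z)%C).
    - apply Rmult_le_compat_l; lra.
    - rewrite EGG. apply Rmult_le_compat_l; lra. }
  assert (Hpos : 0 < radius_poly p alpha beta A B rho).
  { destruct Hr as (_ & Er & _). rewrite <- Er.
    apply radius_poly_decreasing; auto; lra. }
  rewrite radius_poly_factor in Hpos. fold c in Hpos.
  set (x := Cmod (phi z)) in *. set (y := Cmod Dphi) in *.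
  set (u := Cmod (G z)) in *. set (v := Cmod (G1 z)) in *.
  assert (Hkey : beta * rho * y * u <= c * (1 - x) * v).
  (* Multiplying by [N] clears both denominators at once: [1 - rho^2] from Schwarz-Pick and
     [1 - |A| rho] from the subordination. *)
  { set (N := (1 - rho ^ 2) * (1 - Rabs A * rho)) in *.
    assert (HN : 0 < N) by (apply Rmult_lt_0_compat; [nra|easy]).
    apply Rmult_le_reg_r with N; [easy|].
    assert (HBp : 0 <= 1 + Rabs B * rho) by (pose proof (Rabs_pos B); nra).
    apply Rle_trans with ((beta * rho) * ((1 - x ^ 2) * (v * (1 + Rabs B * rho)))).
    { replace (beta * rho * y * u * N)
        with ((beta * rho) * ((y * (1 - rho ^ 2)) * (u * (1 - Rabs A * rho))))
        by (unfold N; ring).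
      apply Rmult_le_compat_l; [nra|].
      apply Rmult_le_compat; [| |easy|easy]; apply Rmult_le_pos; nra. }
    assert (HT : 0 <= (1 - x) * v) by (apply Rmult_le_pos; lra).
    assert (HS : 0 <= beta * (rho * (1 + Rabs B * rho))) by (repeat apply Rmult_le_pos; lra).
    apply Rle_trans with ((1 - x) * v * (2 * beta * (rho * (1 + Rabs B * rho)))).
    { replace ((beta * rho) * ((1 - x ^ 2) * (v * (1 + Rabs B * rho))))
        with ((1 - x) * v * ((1 + x) * (beta * (rho * (1 + Rabs B * rho))))) by ring.
      apply Rmult_le_compat_l; [easy|]. nra. }
    replace (c * (1 - x) * v * N) with ((1 - x) * v * (c * N)) by ring.
    apply Rmult_le_compat_l; [easy|lra]. }
  apply Rmult_le_reg_l with c; [easy|]. lra.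
Qed.
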